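(* Let $N\ge 3$ be an integer, let $p>1$, and let $a,b\in\mathbb{R}$ satisfy $b>a-2>-N$. Put $p_S(a,b)=\frac{N+2+2b-a}{N-2+a}$ and consider the equation $$\operatorname{div}(|x|^{a}Du)+|x|^{b}u^{p}=0,\quad u>0,\ \text{ in }\mathbb{R}^N. \tag{$*$}$$ (a) Equation $( * )$ has no positive solution if $p<p_S(a,b)$. (b) Equation $( * )$ admits a positive solution if $p\ge p_S(a,b)$.
   Context: $Du$ denotes the gradient of $u$. A positive solution of $( * )$ is a function $u:\mathbb{R}^N\to(0,\infty)$ of class $C^2(\mathbb{R}^N\setminus\{0\})\cap C(\mathbb{R}^N)$ satisfying the equation pointwise everywhere in $\mathbb{R}^N\setminus\{0\}$. *)

(* Defs.v *)
From HB Require Import structures.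
From mathcomp Require Import all_boot all_order all_algebra.
From mathcomp Require Import all_classical all_reals all_analysis.

Set Implicit Arguments.
Unset Strict Implicit.
Unset Printing Implicit Defensive.

Import Order.TTheory GRing.Theory Num.Theory.
Import numFieldNormedType.Exports.

Local Open Scope classical_set_scope.
Local Open Scope ring_scope.

(* R^N is 'rV[R]_N. The canonical norm on 'rV[R]_N is
   the sup norm (it only provides the topology), so the Euclidean norm |x| of
   the equation is defined separately. *)
Definition enorm (R : realType) (N : nat) (x : 'rV[R]_N) : R :=
  Num.sqrt (\sum_(i < N) x 0 i ^+ 2).

Definition evec (R : realType) (N : nat) (i : 'I_N) : 'rV[R]_N := delta_mx 0 i.

Definition partial (R : realType) (N : nat) (i : 'I_N)
    (f : 'rV[R]_N -> R) : 'rV[R]_N -> R :=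
  'D_(evec R i) f.

Definition grad (R : realType) (N : nat) (f : 'rV[R]_N -> R)
    (x : 'rV[R]_N) : 'rV[R]_N :=
  \row_i partial i f x.

Definition divergence (R : realType) (N : nat) (F : 'rV[R]_N -> 'rV[R]_N)
    (x : 'rV[R]_N) : R :=
  \sum_(i < N) partial i (fun y => F y 0 i) x.

(* f is of class C^2 on D, for D open. Since 'D is total, existence of each
   partial derivative is required explicitly. *)
Definition C2_on (R : realType) (N : nat) (D : set 'rV[R]_N)
    (f : 'rV[R]_N -> R) : Prop :=
  forall x, D x ->
  [/\ {for x, continuous f},
      forall i, derivable f x (evec R i) /\ {for x, continuous (partial i f)}
    & forall i j, derivable (partial i f) x (evec R j) /\
                  {for x, continuous (partial j (partial i f))}].

(* The real powers |x|^a and |x|^b are only evaluated at x <> 0 and u^p at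
   u x > 0, so powR is used on positive bases only (partial derivatives at
   x <> 0 only depend on values near x). *)
Definition positive_solution (R : realType) (N : nat) (a b p : R)
    (u : 'rV[R]_N -> R) : Prop :=
  [/\ forall x, 0 < u x,
      C2_on [set x : 'rV[R]_N | x != 0] u,
      continuous u
    & forall x : 'rV[R]_N, x != 0 ->
      divergence (fun y => (enorm y `^ a) *: grad u y) x
        + enorm x `^ b * u x `^ p = 0].

Definition p_S (R : realType) (N : nat) (a b : R) : R :=
  (N%:R + 2 + 2 * b - a) / (N%:R - 2 + a).

(* Main.v *)
Require Import Defs.
From HB Require Import structures.
From mathcomp Require Import all_boot all_order all_algebra.
From mathcomp Require Import all_classical all_reals all_analysis.
From mathcomp Require Import ring lra.

Import Order.TTheory GRing.Theory Num.Theory.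
Import numFieldNormedType.Exports.

Local Open Scope classical_set_scope.
Local Open Scope ring_scope.

Set Implicit Arguments.
Unset Strict Implicit.
Unset Printing Implicit Defensive.

(** Part (a). Put g = (N - 2 + a) / 2 > 0 and, for a positive solution u,
    w x = |x|^g u x. In cylindrical coordinates x = e^t theta the equation reads
      w_tt + Lap_theta w - g^2 w + |x|^d w^p = 0,   d = b - a + 2 - g (p - 1),
    and p < p_S means exactly d > 0. This is set up without coordinates on the
    sphere: Lap_theta w is half the sum over i <> j of the second derivatives
    along the rotations in the (i, j)-planes, and w_tt is the second derivative
    along the dilations ([is_cyl_lap], [is_cyl_lap_solution]). The operator is
    nonnegative at a local minimum, and it commutes with the inversion
    x |-> lam^2 x / |x|^2, which is the reflection t |-> 2 ln lam - t. The method of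
    moving planes in t, that is, of moving spheres centred at the origin, then
    shows w x <= w (lam^2 x / |x|^2) for every |x| <= lam and every lam > 0
    ([reflects_all]). It starts because w tends to 0 at the origin while
    |x|^d w^(p-1) = |x|^(b-a+2) u^(p-1) also does. It never stops because d > 0 makes
    the reflected function a strict supersolution, which gives strict inequality
    inside without a strong maximum principle, and because a barrier depending on
    |x| only gives a positive radial derivative on the sphere |x| = lam
    ([reflects_hopf]). Hence w is nondecreasing along rays and bounded below by a
    positive constant for |x| >= 1, so that |x|^d w^(p-1) exceeds g^2 + 1 far away;
    there w is a supersolution of f_tt + Lap_theta f + f = 0, and touching it from
    below with a multiple of sin (ln |x| - T) on an annulus with ln |x| in
    [T, T + pi] is a contradiction ([no_cyl_solution]).

    Part (b). For sg = b - a + 2 > 0 a radial function u x = U (|x|^sg / sg^2) solves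
    the equation when s U'' + k U' + U^p = 0 with k = 1 + 2 g / sg, and then
    p_S = (k + 1) / (k - 1). In integrated form the initial value U 0 = 1 is a
    fixed point problem which, after the power is replaced by a globally Lipschitz
    one, is solved on the whole half line by Picard iteration in a norm with
    exponential weight ([picard_fixpoint]). The solution stays in (0, 1], where the
    modification is invisible: the Pohozaev function
      P = s^(k+1) U'^2 + (2 / (p + 1)) s^k U^(p+1) + (k - 1) s^k U U'
    vanishes at 0 and is nonincreasing exactly when p >= p_S, but it would be
    positive at a first zero of U ([emden_positive]). *)

(** * Second derivatives of functions of one variable *)
Lemma is_derive_cont {R : realType} (g : R -> R) (x l : R) :
  is_derive x (1 : R) g l -> {for x, continuous g}.
Proof. by move=> [? _]; apply/differentiable_continuous/derivable1_diffP. Qed.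

(** This rule and the following ones are for expressions under a binder, and leave
    the value of the derivative to be matched up to a provable equality. *)
Lemma is_derive_funM {R : realType} (f g : R -> R) (x df dg l : R) :
  is_derive x (1 : R) f df -> is_derive x (1 : R) g dg ->
  l = df * g x + f x * dg -> is_derive x (1 : R) (fun s => f s * g s) l.
Proof.
move=> hf hg ->; have h := is_deriveM hf hg.
by apply: (is_derive_eq (df := _) h); rewrite /GRing.scale/= addrC mulrC.
Qed.

Lemma is_derive_funD {R : realType} (f g : R -> R) (x df dg l : R) :
  is_derive x (1 : R) f df -> is_derive x (1 : R) g dg ->
  l = df + dg -> is_derive x (1 : R) (fun s => f s + g s) l.
Proof. by move=> hf hg ->; exact: (is_deriveD hf hg). Qed.

Lemma is_derive_funB {R : realType} (f g : R -> R) (x df dg l : R) :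
  is_derive x (1 : R) f df -> is_derive x (1 : R) g dg ->
  l = df - dg -> is_derive x (1 : R) (fun s => f s - g s) l.
Proof. by move=> hf hg ->; exact: (is_deriveB hf hg). Qed.

Lemma is_derive_funN {R : realType} (f : R -> R) (x df l : R) :
  is_derive x (1 : R) f df -> l = - df ->
  is_derive x (1 : R) (fun s => - f s) l.
Proof. by move=> hf ->; exact: (is_deriveN hf). Qed.

Lemma is_derive_funC {R : realType} (c x l : R) : l = 0 ->
  is_derive x (1 : R) (fun=> c) l.
Proof. by move=> ->; exact: is_derive_cst. Qed.

Lemma is_derive_funId {R : realType} (x l : R) : l = 1 ->
  is_derive x (1 : R) (fun s => s) l.
Proof. by move=> ->; exact: is_derive_id. Qed.

Lemma is_derive_funZ {R : realType} (f : R -> R) (c x df l : R) :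
  is_derive x (1 : R) f df -> l = c * df ->
  is_derive x (1 : R) (fun s => c * f s) l.
Proof.
by move=> hf ->; apply: (is_derive_funM (@is_derive_funC _ c x 0 erefl) hf); rewrite mul0r add0r.
Qed.

Lemma is_derive_fun_comp {R : realType} (f g : R -> R) (x df dg l : R) :
  is_derive (g x) (1 : R) f df -> is_derive x (1 : R) g dg ->
  l = df * dg -> is_derive x (1 : R) (fun s => f (g s)) l.
Proof. by move=> hf hg ->; exact: (is_derive1_comp hf hg). Qed.

(** First derivative [d] and second derivative [l] at 0, as a relation: it carries
    the differentiability near 0 that the second derivative needs, so that sums,
    products and reparametrisations can be formed without side conditions. *)
Definition is_deriv2 {R : realType} (g : R -> R) (d l : R) : Prop :=
  exists g' : R -> R, [/\ \forall s \near (0 : R), is_derive (s : R) (1 : R) g (g' s),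
                          g' 0 = d & is_derive (0 : R) 1 g' l].

Lemma is_deriv2_derive {R : realType} (g : R -> R) (d l : R) :
  is_deriv2 g d l -> is_derive (0 : R) 1 g d.
Proof. by move=> [g' [/nbhs_singleton hg <- _]]. Qed.

(** The first derivative vanishes at the minimum; were the second one negative, the
    first one would be negative just to the right of 0, and the function would
    decrease there by the mean value theorem. *)
Lemma is_deriv2_min {R : realType} (g : R -> R) (d l : R) :
  is_deriv2 g d l -> (\forall s \near (0 : R), g 0 <= g s) -> 0 <= l.
Proof.
move=> [g' [dg g'0 dg']] gmin.
have /nbhs_ballP[e /= e0 he] : \forall s \near (0 : R),
    is_derive (s : R) (1 : R) g (g' s) /\ g 0 <= g s by apply: filterI.
have ballP (s : R) : - e < s < e -> is_derive (s : R) (1 : R) g (g' s) /\ g 0 <= g s.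
  move=> se; apply: he; rewrite /ball /= sub0r normrN ltr_norml; exact: se.
have d0 : d = 0.
  have h1 : is_derive (0 : R) (1 : R) g 0.
    apply: (@derive1_at_min _ _ (- e) e) => //; first by lra.
    - by move=> t; rewrite in_itv/= => /ballP[[]].
    - by rewrite in_itv/=; lra.
    - by move=> t; rewrite in_itv/= => /ballP[].
  have [|h2 _] := ballP 0; first by lra.
  by rewrite -g'0 -(@derive_val _ _ _ _ _ _ _ h2) (@derive_val _ _ _ _ _ _ _ h1).
rewrite leNgt; apply/negP => l0.
have /is_derive1_caratheodory[h [hE hc h0]] := dg'.
have /nbhs_ballP[r /= r0 hr] : \forall s \near (0 : R), h s < 0.
  by apply: (cvgr_lt _ hc); rewrite h0.
pose s := Num.min e r / 2.
have m0 : 0 < Num.min e r by rewrite lt_min e0 r0.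
have me : Num.min e r <= e by rewrite ge_min lexx.
have mr : Num.min e r <= r by rewrite ge_min lexx orbT.
have s0 : 0 < s by rewrite /s; lra.
have [c||c] := @MVT _ g g' 0 s s0.
- by rewrite in_itv/= => /andP[c0 cs]; apply: (proj1 (ballP c _)); rewrite /s in cs; lra.
- apply: derivable_within_continuous => c; rewrite in_itv/= => /andP[c0 cs].
  by apply: (@ex_derive _ _ _ _ _ _ _ (proj1 (ballP c _))); rewrite /s in cs; lra.
rewrite in_itv/= => /andP[c0 cs] eqg.
have hc0 : h c < 0.
  by apply: hr; rewrite /ball /= sub0r normrN gtr0_norm // ; rewrite /s in cs; lra.
have gc : g' c = h c * c by have := hE c; rewrite g'0 d0 !subr0.
have [_ ] : is_derive (s : R) (1 : R) g (g' s) /\ g 0 <= g s by apply: ballP; rewrite /s in s0 *; lra.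
rewrite -subr_ge0 eqg gc subr0; apply/negP; rewrite -ltNge.
by rewrite pmulr_llt0 // pmulr_llt0.
Qed.

Lemma is_deriv2_ext {R : realType} (f g : R -> R) (d l : R) :
  f =1 g -> is_deriv2 f d l -> is_deriv2 g d l.
Proof. by move=> /funext ->. Qed.

Lemma is_deriv2_eq {R : realType} (f : R -> R) (d l d' l' : R) :
  is_deriv2 f d l -> d = d' -> l = l' -> is_deriv2 f d' l'.
Proof. by move=> h <- <-. Qed.

Lemma is_deriv2B {R : realType} (f g : R -> R) (df lf dg lg : R) :
  is_deriv2 f df lf -> is_deriv2 g dg lg ->
  is_deriv2 (fun s => f s - g s) (df - dg) (lf - lg).
Proof.
move=> [f' [hf <- hf']] [g' [hg <- hg']]; exists (fun s => f' s - g' s).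
split => //; last exact: is_derive_funB hf' hg' erefl.
near=> s; have hfs : is_derive s (1 : R) f (f' s) by near: s.
have hgs : is_derive s (1 : R) g (g' s) by near: s.
exact: is_derive_funB hfs hgs erefl.
Unshelve. all: by end_near. Qed.

Lemma is_deriv2M {R : realType} (f g : R -> R) (df lf dg lg : R) :
  is_deriv2 f df lf -> is_deriv2 g dg lg ->
  is_deriv2 (fun s => f s * g s) (df * g 0 + f 0 * dg)
    (lf * g 0 + 2 * (df * dg) + f 0 * lg).
Proof.
move=> Hf Hg; have f0 := is_deriv2_derive Hf; have g0 := is_deriv2_derive Hg.
case: Hf Hg => [f' [hf f'0 hf']] [g' [hg g'0 hg']].
exists (fun s => f' s * g s + f s * g' s); split.
- near=> s; have hfs : is_derive s (1 : R) f (f' s) by near: s.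
  have hgs : is_derive s (1 : R) g (g' s) by near: s.
  exact: is_derive_funM hfs hgs erefl.
- by rewrite f'0 g'0.
- apply: is_derive_funD (is_derive_funM hf' g0 erefl) (is_derive_funM f0 hg' erefl) _.
  by rewrite f'0 g'0; ring.
Unshelve. all: by end_near. Qed.

Lemma is_deriv2_intro {R : realType} (g g' : R -> R) (d l : R) :
  (forall s, is_derive s (1 : R) g (g' s)) -> g' 0 = d ->
  is_derive (0 : R) (1 : R) g' l -> is_deriv2 g d l.
Proof.
by move=> h1 h2 h3; exists g'; split => //; near=> s; exact: h1.
Unshelve. all: by end_near. Qed.

Lemma is_deriv2Z {R : realType} (c : R) (f : R -> R) (d l : R) :
  is_deriv2 f d l -> is_deriv2 (fun t => c * f t) (c * d) (c * l).
Proof.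
have hC : is_deriv2 (fun=> c) 0 0 by apply: (is_deriv2_intro (g' := fun=> 0)) => // [s|]; exact: is_derive_funC.
by move=> h; have := is_deriv2M hC h; rewrite !mul0r mulr0 !add0r.
Qed.

Lemma is_deriv2_opp {R : realType} (f : R -> R) (d l : R) :
  is_deriv2 f d l -> is_deriv2 (fun s => f (- s)) (- d) l.
Proof.
move=> [f' [hf f'0 hf']]; exists (fun s => - f' (- s)).
have on (s : R) : is_derive (s : R) (1 : R) -%R (-1) by apply: is_deriveNid.
split; last 1 first.
- have := @is_derive1_comp _ f' -%R 0 l (-1).
  rewrite oppr0 => /(_ hf' (on 0)) h.
  by apply: is_derive_funN h _; rewrite mulrN1 opprK.
- have /nbhs_ballP[e /= e0 he] := hf.
  apply/nbhs_ballP; exists e => //= s; rewrite /ball/= sub0r normrN => se.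
  have hs : is_derive (- s) (1 : R) f (f' (- s)).
    by apply: he; rewrite /ball/= sub0r opprK.
  have := @is_derive1_comp _ f -%R s _ _ hs (on s).
  by rewrite mulrN1.
- by rewrite oppr0 f'0.
Qed.

(** * The chain rule for functions with continuous partial derivatives *)
(** Both sides are limits of the same difference quotient; this turns directional
    derivatives into derivatives of functions of one variable and back. *)
Lemma is_derive_line {R : realType} {N : nat} (f : 'rV[R]_N -> R)
    (z v : 'rV[R]_N) (t l : R) :
  is_derive t (1 : R) (fun s : R => f (z + s *: v)) l <->
  is_derive (z + t *: v) v f l.
Proof.
have E : (fun h : R => h^-1 *: (((fun s : R => f (z + s *: v)) \o shift t) (h *: 1)
            - f (z + t *: v))) =
         (fun h => h^-1 *: ((f \o shift (z + t *: v)) (h *: v) - f (z + t *: v))).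
  apply/funext => h /=; congr (_ *: (f _ - _)).
  by rewrite [h *: 1]mulr1 scalerDl addrCA.
split=> -[d1 d2]; split.
- by move: d1; rewrite /derivable E.
- by move: d2; rewrite /derive E.
- by rewrite /derivable E.
- by rewrite /derive E.
Qed.

Lemma cvg_sum_ord {R : realType} {T : Type} (F : set_system T) {FF : Filter F}
    (n : nat) (f : 'I_n -> T -> R) (l : 'I_n -> R) :
  (forall k, f k @ F --> l k) ->
  (fun t => \sum_k f k t) @ F --> \sum_k l k.
Proof.
move=> h; elim: (index_enum _) => [|k r ih].
  by rewrite big_nil; under eq_fun do rewrite big_nil; exact: cvg_cst.
by rewrite big_cons; under eq_fun do rewrite big_cons; exact: cvgD.
Qed.

Lemma cvg_rV {R : realType} {N : nat} {T : Type} (F : set_system T) {FF : Filter F}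
    (c : T -> 'rV[R]_N) (x : 'rV[R]_N) :
  (forall k, (fun t => c t 0 k) @ F --> x 0 k) -> c @ F --> x.
Proof.
move=> h; apply/cvg_ballP => e e0.
have : \forall t \near F, forall k, ball (x 0 k) e (c t 0 k).
  by apply: filter_forall => k; have /cvg_ballP := h k; apply.
by apply: filterS => t ht; split => // i j; rewrite ord1.
Qed.

(** Walk from [x] to [y] along the coordinate axes, one coordinate at a time: by the
    mean value theorem each increment is a partial derivative at a nearby point
    times the increment of that coordinate. This is the form of differentiability
    from which the chain rule follows by continuity alone. *)
Lemma hadamard_decomposition {R : realType} {N : nat} (f : 'rV[R]_N -> R) (x : 'rV[R]_N) :
  (forall k, \forall y \near x, derivable f y (evec R k)) ->
  (forall k, {for x, continuous (partial k f)}) ->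
  exists g : 'I_N -> 'rV[R]_N -> R,
    [/\ forall y, f y - f x = \sum_k g k y * (y 0 k - x 0 k),
        forall k, {for x, continuous (g k)} &
        forall k, g k x = partial k f x].
Proof.
move=> df cf.
(* the first m coordinates of y, the others of x *)
pose z (y : 'rV[R]_N) (m : nat) : 'rV[R]_N :=
  \row_i (if (i < m)%N then y 0 i else x 0 i).
pose g (k : 'I_N) (y : 'rV[R]_N) := if y 0 k == x 0 k then partial k f x
  else (f (z y k.+1) - f (z y k)) / (y 0 k - x 0 k).
have zS y (k : 'I_N) : z y k.+1 = z y k + (y 0 k - x 0 k) *: evec R k.
  apply/rowP => i; have [->|ne] := eqVneq i k; rewrite !mxE !eqxx /=.
    by rewrite ltnSn ltnn mulr1 addrC subrK.
  have nv : (i : nat) == k = false by rewrite -(negbTE ne).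
  by rewrite (negbTE ne) mulr0 addr0 ltnS leq_eqVlt nv.
exists g; split.
- move=> y.
  have zN : z y N = y by apply/rowP => i; rewrite mxE ltn_ord.
  have z0 : z y 0 = x by apply/rowP => i; rewrite mxE.
  rewrite -[in LHS]zN -[in f x]z0 -(telescope_sumr (fun m => f (z y m))) //.
  rewrite big_mkord; apply: eq_bigr => k _; rewrite /g.
  case: eqP => [e|/eqP ne]; last by rewrite divfK // subr_eq0.
  by rewrite zS e subrr mulr0 scale0r addr0 subrr.
- move=> k; apply/(cvgrPdist_lt (FF := nbhs_filter x)) => e e0 /=.
  have := cf k; move=> /(cvgrPdist_lt (FF := nbhs_filter x))/(_ e e0)/(filterI (df k)).
  move=> /nbhs_ballP[r /= r0 hr]; apply/nbhs_ballP; exists r => //= y [_ xy].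
  rewrite /g eqxx; case: eqP => [_|/eqP ne]; first by rewrite subrr normr0.
  pose d := y 0 k - x 0 k.
  pose phi (t : R) := f (z y k + (t * d) *: evec R k).
  have inb (t : R) : 0 <= t <= 1 -> ball x r (z y k + (t * d) *: evec R k).
    move=> t01; split => // i j; rewrite ord1 !mxE eqxx /=.
    have [->|jk] := eqVneq j k.
      rewrite ltnn mulr1 /ball /= /d.
      have := xy 0 k; rewrite /ball /= !ltr_norml => /andP[h1 h2].
      by apply/andP; split; nra.
    rewrite mulr0 addr0; case: ifP => _; first exact: xy.
    exact: ballxx.
  have dphi (t : R) : 0 <= t <= 1 ->
      is_derive t (1 : R) phi (partial k f (z y k + (t * d) *: evec R k) * d).
    move=> /inb/hr[h _].
    have h1 : is_derive (t * d) (1 : R) (fun s : R => f (z y k + s *: evec R k))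
        (partial k f (z y k + (t * d) *: evec R k)).
      by apply/is_derive_line; exact: derivableP.
    apply: (is_derive_fun_comp (g := fun t => t * d) h1 _ erefl).
    by apply: is_derive_funM (is_derive_funId _ erefl) (is_derive_funC _ _ erefl) _; rewrite mul1r mulr0 addr0.
  have [||t] := @MVT _ phi (fun t => partial k f (z y k + (t * d) *: evec R k) * d)
     0 1 ltr01.
  + by move=> t; rewrite in_itv/= => /andP[t0 t1]; apply: dphi; rewrite !ltW.
  + apply: derivable_within_continuous => t; rewrite in_itv/= => t01.
    by apply: (@ex_derive _ _ _ _ _ _ _ (dphi t t01)).
  rewrite in_itv/= => /andP[t0 t1]; rewrite /phi mul1r mul0r scale0r addr0 subr0 mulr1.
  rewrite -zS => ->; rewrite mulfK ?subr_eq0 //.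
  by have [] := hr _ (inb t _); rewrite ?ltW.
- by move=> k; rewrite /g eqxx.
Qed.

Lemma chain_partial {R : realType} {N : nat} (f : 'rV[R]_N -> R)
    (c : R -> 'rV[R]_N) (s : R) (v : 'I_N -> R) :
  (forall k, \forall y \near c s, derivable f y (evec R k)) ->
  (forall k, {for c s, continuous (partial k f)}) ->
  (forall k, is_derive s (1 : R) (fun t => c t 0 k) (v k)) ->
  is_derive s (1 : R) (fun t => f (c t)) (\sum_k partial k f (c s) * v k).
Proof.
move=> df cf dc; have [g [gE gc gx]] := hadamard_decomposition df cf.
have cc : c t @[t --> s] --> c s.
  by apply: cvg_rV => k; have := is_derive_cont (dc k).
have /choice[h hP] : forall k, exists h : R -> R,
    [/\ forall t, c t 0 k - c s 0 k = h t * (t - s), {for s, continuous h} & h s = v k].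
  by move=> k; apply/(@is_derive1_caratheodory _ (fun t => c t 0 k)); exact: dc.
apply/is_derive1_caratheodory; exists (fun t => \sum_k g k (c t) * h k t); split.
- move=> t; rewrite gE mulr_suml; apply: eq_bigr => k _.
  by have [-> _ _] := hP k; rewrite mulrA.
- apply: cvg_sum_ord => k; have [_ hc _] := hP k; apply: cvgM => //.
  exact: cvg_comp cc (gc k).
- by apply: eq_bigr => k _; have [_ _ ->] := hP k; rewrite gx.
Qed.

(** Second derivative along a curve with velocity [v] and acceleration [a 0]:
    Hessian in the direction of the velocity plus gradient against the
    acceleration. The mixed partial derivatives are kept in both orders, so their
    symmetry does not enter. *)
Lemma is_deriv2_curve {R : realType} {N : nat} (D : set 'rV[R]_N) (f : 'rV[R]_N -> R)
    (c : R -> 'rV[R]_N) (v : 'I_N -> R -> R) (a : 'I_N -> R) :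
  open D -> C2_on D f -> D (c 0) ->
  (forall k t, is_derive t (1 : R) (fun t => c t 0 k) (v k t)) ->
  (forall k, is_derive (0 : R) (1 : R) (v k) (a k)) ->
  is_deriv2 (fun t => f (c t)) (\sum_k partial k f (c 0) * v k 0)
    (\sum_k ((\sum_l partial l (partial k f) (c 0) * v l 0) * v k 0
              + partial k f (c 0) * a k)).
Proof.
move=> Do Cf Dc dc dv.
exists (fun t => \sum_k partial k f (c t) * v k t); split => //.
- have cc : {for 0, continuous c}.
    by apply: cvg_rV => k; have := is_derive_cont (dc k 0).
  have nD : \forall t \near (0 : R), D (c t).
    by apply: cc; exact: open_nbhs_nbhs.
  near=> t; have Dt : D (c t) by near: t.
  apply: chain_partial => k //; last by have [_ /(_ k)[]] := Cf _ Dt.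
  have : nbhs (c t) D by exact: open_nbhs_nbhs.
  by apply: filterS => y /Cf[_ /(_ k)[]].
- have h k : is_derive (0 : R) (1 : R) (fun t => partial k f (c t) * v k t)
      ((\sum_l partial l (partial k f) (c 0) * v l 0) * v k 0
              + partial k f (c 0) * a k).
    apply: is_derive_funM (dv k) erefl; apply: chain_partial => l //.
    + have : nbhs (c 0) D by exact: open_nbhs_nbhs.
      by apply: filterS => y /Cf[_ _ /(_ k l)[]].
    + by have [_ _ /(_ k l)[]] := Cf _ Dc.
  by have := is_derive_sum h; rewrite fct_sumE.
Unshelve. all: by end_near. Qed.

(** * Rotations, dilations and the Laplacian of the cylinder *)
Definition nsq {R : realType} {N : nat} (x : 'rV[R]_N) : R :=
  \sum_(k < N) x 0 k ^+ 2.

Lemma nsq_ge0 {R : realType} {N : nat} (x : 'rV[R]_N) : 0 <= nsq x.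
Proof. by apply: sumr_ge0 => k _; exact: sqr_ge0. Qed.

Lemma nsq_gt0 {R : realType} {N : nat} (x : 'rV[R]_N) : (0 < nsq x) = (x != 0).
Proof.
rewrite lt_neqAle nsq_ge0 andbT eq_sym; congr (~~ _); apply/eqP/eqP; last first.
  by move=> ->; apply: big1 => k _; rewrite mxE expr0n.
move=> /eqP; rewrite psumr_eq0; last by move=> k _; exact: sqr_ge0.
move=> /allP h; apply/rowP => k; rewrite mxE.
by apply/eqP; rewrite -sqrf_eq0; apply: h; rewrite mem_index_enum.
Qed.

Lemma nsqZ {R : realType} {N : nat} (c : R) (x : 'rV[R]_N) :
  nsq (c *: x) = c ^+ 2 * nsq x.
Proof. by rewrite mulr_sumr; apply: eq_bigr => k _; rewrite mxE exprMn. Qed.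

Lemma enorm_gt0 {R : realType} {N : nat} (x : 'rV[R]_N) : (0 < enorm x) = (x != 0).
Proof. by rewrite sqrtr_gt0 nsq_gt0. Qed.

Lemma enorm_ge0 {R : realType} {N : nat} (x : 'rV[R]_N) : 0 <= enorm x.
Proof. exact: sqrtr_ge0. Qed.

Lemma sqr_enorm {R : realType} {N : nat} (x : 'rV[R]_N) : enorm x ^+ 2 = nsq x.
Proof. by rewrite sqr_sqrtr // nsq_ge0. Qed.

Lemma enormZ {R : realType} {N : nat} (c : R) (x : 'rV[R]_N) :
  enorm (c *: x) = `|c| * enorm x.
Proof.
by rewrite /enorm -/(nsq _) nsqZ sqrtrM ?sqr_ge0 // sqrtr_sqr.
Qed.

Lemma powR_enorm {R : realType} {N : nat} (x : 'rV[R]_N) (a : R) :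
  enorm x `^ a = nsq x `^ (a / 2).
Proof.
by rewrite /enorm -/(nsq x) -powR12_sqrt ?nsq_ge0 // -powRrM mulrC.
Qed.

Lemma powR_add {R : realType} (x a b : R) : 0 < x -> x `^ (a + b) = x `^ a * x `^ b.
Proof. by move=> x0; rewrite powRD //; apply/implyP => _; rewrite gt_eqF. Qed.

Lemma sum_delta {R : realType} {N : nat} (F : 'I_N -> R) (i : 'I_N) :
  \sum_k F k * (k == i)%:R = F i.
Proof.
rewrite (bigD1 i) //= eqxx mulr1 big1 ?addr0 // => k /negbTE ->.
by rewrite mulr0.
Qed.

(** For i <> j, the rotation by the angle [t] in the coordinate plane (i, j). *)
Definition rot {R : realType} {N : nat} (i j : 'I_N) (t : R) (x : 'rV[R]_N)
    : 'rV[R]_N :=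
  \row_k (x 0 k + (cos t - 1) * (x 0 i * (k == i)%:R + x 0 j * (k == j)%:R)
          + sin t * (x 0 i * (k == j)%:R - x 0 j * (k == i)%:R)).

Lemma rot0 {R : realType} {N : nat} (i j : 'I_N) (x : 'rV[R]_N) : rot i j 0 x = x.
Proof. by apply/rowP => k; rewrite mxE cos0 sin0 subrr !mul0r !addr0. Qed.

Lemma rotZ {R : realType} {N : nat} (i j : 'I_N) (t c : R) (x : 'rV[R]_N) :
  rot i j t (c *: x) = c *: rot i j t x.
Proof. by apply/rowP => k; rewrite !mxE; ring. Qed.

Lemma nsq_rot {R : realType} {N : nat} (i j : 'I_N) (t : R) (x : 'rV[R]_N) :
  i != j -> nsq (rot i j t x) = nsq x.
Proof.
move=> ij; have ji : j != i by rewrite eq_sym.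
rewrite /nsq (bigD1 i) //= (bigD1 j) //= [in RHS](bigD1 i) //= [in RHS](bigD1 j) //=.
rewrite !mxE !eqxx (negbTE ij) (negbTE ji).
rewrite (eq_bigr (fun k => x 0 k ^+ 2)); last first.
  by move=> k /andP[/negbTE ki /negbTE kj]; rewrite mxE ki kj; rewrite !(mulr0, addr0, subr0).
have cs := cos2Dsin2 t.
set S := \sum_(k | _) _.
suff : forall c s y z : R, c ^+ 2 + s ^+ 2 = 1 ->
  (y + (c - 1) * (y * 1 + z * 0) + s * (y * 0 - z * 1)) ^+ 2 +
  ((z + (c - 1) * (y * 0 + z * 1) + s * (y * 1 - z * 0)) ^+ 2 + S) =
  y ^+ 2 + (z ^+ 2 + S) by apply.
move=> c s y z h.
transitivity ((c ^+ 2 + s ^+ 2) * (y ^+ 2 + z ^+ 2) + S); first by ring.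
by rewrite h mul1r addrA.
Qed.

Lemma enorm_rot {R : realType} {N : nat} (i j : 'I_N) (t : R) (x : 'rV[R]_N) :
  i != j -> enorm (rot i j t x) = enorm x.
Proof. by move=> ij; rewrite /enorm -!/(nsq _) nsq_rot. Qed.

(** [L] is the value at [x] of the Laplacian of the cylinder (log-radius times unit
    sphere). Half the sum over i <> j of the squares of the infinitesimal rotations
    is the Laplacian of the sphere, and dilations are translations in the
    log-radius. Written along these flows the operator commutes with rotations,
    dilations and inversions, and it is visibly nonnegative at a local minimum. *)
Definition is_cyl_lap {R : realType} {N : nat} (f : 'rV[R]_N -> R) (x : 'rV[R]_N)
    (L : R) : Prop :=
  exists (dA A : 'I_N -> 'I_N -> R) (d B : R),
    [/\ forall i j, i != j -> is_deriv2 (fun t => f (rot i j t x)) (dA i j) (A i j),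
        is_deriv2 (fun t => f (expR t *: x)) d B &
        L = (\sum_i \sum_(j | i != j) A i j) / 2 + B].

Lemma is_cyl_lapB {R : realType} {N : nat} (f g : 'rV[R]_N -> R) (x : 'rV[R]_N) (L M : R) :
  is_cyl_lap f x L -> is_cyl_lap g x M -> is_cyl_lap (fun y => f y - g y) x (L - M).
Proof.
move=> [dA [A [d [B [hA hB ->]]]]] [dA' [A' [d' [B' [hA' hB' ->]]]]].
exists (fun i j => dA i j - dA' i j), (fun i j => A i j - A' i j), (d - d'), (B - B').
split; [by move=> i j ij; apply: is_deriv2B; auto|exact: is_deriv2B|].
under [X in _ = X / 2 + _]eq_bigr => i _ do rewrite sumrB.
by rewrite sumrB; ring.
Qed.

Lemma scale_cvg1 {R : realType} {N : nat} (x : 'rV[R]_N) :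
  expR t *: x @[t --> (0 : R)] --> x.
Proof.
have h : expR t *: x @[t --> (0 : R)] --> expR 0 *: x.
  by apply: cvgZr_tmp; exact: continuous_expR.
by move: h; rewrite expR0 scale1r.
Qed.

Lemma rot_cvg {R : realType} {N : nat} (i j : 'I_N) (x : 'rV[R]_N) :
  rot i j t x @[t --> (0 : R)] --> x.
Proof.
apply: cvg_rV => k.
suff : (fun t => rot i j t x 0 k) @ (0 : R) --> rot i j 0 x 0 k by rewrite rot0.
under eq_fun do rewrite mxE.
rewrite mxE; apply: cvgD; first apply: cvgD; first exact: cvg_cst.
  apply: cvgMr_tmp; apply: cvgB; last exact: cvg_cst.
  exact: continuous_cos.
by apply: cvgMr_tmp; exact: continuous_sin.
Qed.

Lemma is_cyl_lap_min {R : realType} {N : nat} (f : 'rV[R]_N -> R) (x : 'rV[R]_N) (L : R) :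
  is_cyl_lap f x L -> (\forall y \near x, f x <= f y) -> 0 <= L.
Proof.
move=> [dA [A [d [B [hA hB ->]]]]] fmin.
apply: addr_ge0.
  apply: divr_ge0 => //; apply: sumr_ge0 => i _; apply: sumr_ge0 => j ij.
  apply: (is_deriv2_min (hA i j ij)); rewrite rot0.
  exact: (@rot_cvg _ _ i j x _ fmin).
apply: (is_deriv2_min hB); rewrite expR0 scale1r.
exact: (@scale_cvg1 _ _ x _ fmin).
Qed.

(** * The equation in cylindrical form *)
Lemma is_derive_nsq {R : realType} {N : nat} (G : R -> R) (x : 'rV[R]_N) (i : 'I_N)
    (g' : R) :
  is_derive (nsq x) (1 : R) G g' ->
  is_derive x (evec R i) (fun y => G (nsq y)) (g' * (2 * x 0 i)).
Proof.
move=> hG; rewrite -[x in is_derive x](addr0 x) -(scale0r (evec R i)).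
apply/is_derive_line.
have E (t : R) : nsq (x + t *: evec R i) = nsq x + (2 * x 0 i * t + t * t).
  rewrite /nsq (bigD1 i) //= [in RHS](bigD1 i) //= !mxE !eqxx /=.
  rewrite (eq_bigr (fun k => x 0 k ^+ 2)); first by ring.
  by move=> k /negbTE ki; rewrite !mxE ki andbF mulr0 addr0.
have := @is_derive_fun_comp _ G (fun t => nsq x + (2 * x 0 i * t + t * t)) 0 g' (2 * x 0 i) _ _ _ erefl.
rewrite (_ : (fun s : R => G (nsq (x + s *: evec R i))) =
   (fun s => G (nsq x + (2 * x 0 i * s + s * s)))); last by apply/funext => s; rewrite E.
apply; first by rewrite !mulr0 !addr0.
apply: is_derive_funD (is_derive_funC _ _ erefl) (is_derive_funD (is_derive_funZ (is_derive_funId _ erefl) erefl)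
  (is_derive_funM (is_derive_funId _ erefl) (is_derive_funId _ erefl) erefl) erefl) _.
by ring.
Qed.

Lemma open_punctured {R : realType} {N : nat} : open [set x : 'rV[R]_N | x != 0].
Proof.
rewrite (_ : [set x | _] = ~` [set 0]); last first.
  by apply/seteqP; split => y /= /eqP.
by apply: closed_openC; exact: (accessible_closed_set1 (hausdorff_accessible (@norm_hausdorff _ _))).
Qed.

(** The derivative along dilations. *)
Definition euler {R : realType} {N : nat} (u : 'rV[R]_N -> R) (x : 'rV[R]_N) : R :=
  \sum_k x 0 k * partial k u x.

(** The Hessian of [u] at [x] applied twice to [x]. *)
Definition hess_radial {R : realType} {N : nat} (u : 'rV[R]_N -> R) (x : 'rV[R]_N) : R :=
  \sum_k \sum_l x 0 k * x 0 l * partial l (partial k u) x.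

(** Product rule, with grad |y|^a = a |y|^(a-2) y. *)
Lemma divergence_expand {R : realType} {N : nat} (a : R) (u : 'rV[R]_N -> R)
    (x : 'rV[R]_N) : C2_on [set x | x != 0] u -> x != 0 ->
  divergence (fun y => (enorm y `^ a) *: grad u y) x =
  enorm x `^ a * ((\sum_k partial k (partial k u) x) + a / nsq x * euler u x).
Proof.
move=> Cu x0; have n0 : 0 < nsq x by rewrite nsq_gt0.
rewrite mulrDr mulr_sumr mulrA mulr_sumr -big_split /=; apply: eq_bigr => k _.
rewrite /partial -/(partial k u).
have -> : (fun y => ((enorm y `^ a) *: grad u y) 0 k) =
   (fun y => nsq y `^ (a / 2)) * partial k u.
  by apply/funext => y; rewrite !mxE powR_enorm.
have [_ _ /(_ k k)[duk _]] := Cu _ x0.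
have dn : is_derive x (evec R k) (fun y => nsq y `^ (a / 2))
   (a / 2 * nsq x `^ (a / 2 - 1) * (2 * x 0 k)).
  exact: (@is_derive_nsq _ _ (fun q => q `^ (a / 2)) x k _ (is_derive1_powR _ n0)).
have [dn1 dn2] := dn.
rewrite (deriveM dn1 duk) dn2 /GRing.scale /= powR_enorm.
have -> : nsq x `^ (a / 2 - 1) = nsq x `^ (a / 2) / nsq x.
  by rewrite powR_add // powR_inv1 // ltW.
rewrite /partial; field; exact: lt0r_neq0.
Qed.

Lemma positive_solution_expand {R : realType} {N : nat} (a b p : R)
    (u : 'rV[R]_N -> R) (x : 'rV[R]_N) :
  positive_solution a b p u -> x != 0 ->
  nsq x * (\sum_k partial k (partial k u) x) + a * euler u x
  + enorm x `^ (b - a + 2) * u x `^ p = 0.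
Proof.
move=> [up Cu _ eqn] x0; have := eqn x x0.
have e0 : 0 < enorm x by rewrite enorm_gt0.
have n0 : nsq x != 0 by rewrite gt_eqF // nsq_gt0.
rewrite divergence_expand // => h.
have ea : enorm x `^ a != 0 by rewrite gt_eqF // powR_gt0.
apply: (mulfI ea); rewrite mulr0.
set S := \sum_k _ in h *.
transitivity (nsq x * (enorm x `^ a * (S + a / nsq x * euler u x)
   + enorm x `^ b * u x `^ p)); last by rewrite h mulr0.
have -> : enorm x `^ b = enorm x `^ a * enorm x `^ (b - a).
  by rewrite -powR_add // addrC subrK.
have -> : enorm x `^ (b - a + 2) = enorm x `^ (b - a) * nsq x.
  by rewrite powR_add // -sqr_enorm -powR_mulrn ?ltW.
by field.
Qed.

Lemma is_deriv2_rot {R : realType} {N : nat} (u : 'rV[R]_N -> R) (x : 'rV[R]_N) (i j : 'I_N) :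
  C2_on [set x | x != 0] u -> x != 0 ->
  is_deriv2 (fun t => u (rot i j t x)) (x 0 i * partial j u x - x 0 j * partial i u x)
   (x 0 i * (x 0 i * partial j (partial j u) x - x 0 j * partial i (partial j u) x)
    - x 0 j * (x 0 i * partial j (partial i u) x - x 0 j * partial i (partial i u) x)
    - x 0 i * partial i u x - x 0 j * partial j u x).
Proof.
move=> Cu x0.
pose v (k : 'I_N) (t : R) := (- sin t) * (x 0 i * (k == i)%:R + x 0 j * (k == j)%:R)
          + cos t * (x 0 i * (k == j)%:R - x 0 j * (k == i)%:R).
pose acc (k : 'I_N) := - (x 0 i * (k == i)%:R + x 0 j * (k == j)%:R).
have c0 : rot i j 0 x != 0 by rewrite rot0.
have dv k t : is_derive t (1 : R) (fun t => rot i j t x 0 k) (v k t).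
  rewrite (_ : (fun t => _) = (fun t => x 0 k + (cos t - 1) * (x 0 i * (k == i)%:R + x 0 j * (k == j)%:R)
          + sin t * (x 0 i * (k == j)%:R - x 0 j * (k == i)%:R))); last first.
    by apply/funext => s; rewrite mxE.
  apply: is_derive_funD (is_derive_funD (is_derive_funC _ _ erefl) (is_derive_funM (is_derive_funB (is_derive_cos t) (is_derive_funC _ _ erefl) erefl) (is_derive_funC _ _ erefl) erefl) erefl) (is_derive_funM (is_derive_sin t) (is_derive_funC _ _ erefl) erefl) _.
  by rewrite /v; ring.
have da k : is_derive (0 : R) (1 : R) (v k) (acc k).
  apply: is_derive_funD (is_derive_funM (is_derive_funN (is_derive_sin _) erefl) (is_derive_funC _ _ erefl) erefl)
              (is_derive_funM (is_derive_cos _) (is_derive_funC _ _ erefl) erefl) _.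
  by rewrite /acc sin0 cos0; ring.
have v0 k : v k 0 = x 0 i * (k == j)%:R - x 0 j * (k == i)%:R.
  by rewrite /v sin0 cos0 oppr0 mul0r add0r mul1r.
have sumv (F : 'I_N -> R) : \sum_k F k * v k 0 = x 0 i * F j - x 0 j * F i.
  under eq_bigr => k _.
    by rewrite v0 mulrBr !mulrA ![F k * _]mulrC -!mulrA; over.
  by rewrite sumrB -!mulr_sumr !sum_delta.
have suma (F : 'I_N -> R) : \sum_k F k * acc k = - (x 0 i * F i + x 0 j * F j).
  under eq_bigr => k _.
    by rewrite mulrN mulrDr !mulrA ![F k * _]mulrC -!mulrA; over.
  by rewrite sumrN big_split /= -!mulr_sumr !sum_delta.
have h := @is_deriv2_curve _ _ _ u (fun t => rot i j t x) v acc open_punctured Cu c0 dv da.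
apply: (is_deriv2_eq h); rewrite rot0.
  exact: (sumv (fun k => partial k u x)).
rewrite big_split /= (suma (fun k => partial k u x)) opprD addrA.
congr (_ - _ - _).
rewrite (eq_bigr (fun k => (x 0 i * partial j (partial k u) x
   - x 0 j * partial i (partial k u) x) * v k 0)); last first.
  by move=> k _; congr (_ * _); exact: (sumv (fun l => partial l (partial k u) x)).
exact: (sumv (fun k => x 0 i * partial j (partial k u) x
   - x 0 j * partial i (partial k u) x)).
Qed.

Lemma is_deriv2_scale {R : realType} {N : nat} (u : 'rV[R]_N -> R) (x : 'rV[R]_N) :
  C2_on [set x | x != 0] u -> x != 0 ->
  is_deriv2 (fun t => u (expR t *: x)) (euler u x) (hess_radial u x + euler u x).
Proof.
move=> Cu x0.
have c0 : expR (0 : R) *: x != 0 by rewrite expR0 scale1r.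
have dv k t : is_derive t (1 : R) (fun t => (expR t *: x) 0 k) (expR t * x 0 k).
  rewrite (_ : (fun t => _) = (fun t => expR t * x 0 k)); last first.
    by apply/funext => s; rewrite mxE.
  by apply: is_derive_funM (is_derive_expR t) (is_derive_funC _ _ erefl) _; rewrite mulr0 addr0.
have da k : is_derive (0 : R) (1 : R) (fun t => expR t * x 0 k) (x 0 k).
  by apply: is_derive_funM (is_derive_expR _) (is_derive_funC _ _ erefl) _; rewrite mulr0 addr0 expR0 mul1r.
have h := @is_deriv2_curve _ _ _ u (fun t => expR t *: x) (fun k t => expR t * x 0 k) (fun k => x 0 k)
  open_punctured Cu c0 dv da.
apply: (is_deriv2_eq h); rewrite expR0 scale1r.
  by apply: eq_bigr => k _; rewrite mul1r mulrC.
rewrite big_split /=; congr (_ + _).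
  by apply: eq_bigr => k _; rewrite mulr_suml; apply: eq_bigr => l _; ring.
by apply: eq_bigr => k _; rewrite mulrC.
Qed.

(** The squares of the infinitesimal rotations add up to
    2 (|x|^2 Lap - Hess(x, x) - (N - 1) x . grad). Stated for arbitrary families [g] and
    [H] in place of the first and second partial derivatives. *)
Lemma sum_rotations {R : realType} {N : nat} (x g : 'I_N -> R) (H : 'I_N -> 'I_N -> R) :
  \sum_i \sum_(j | i != j) (x i * (x i * H j j - x j * H j i)
    - x j * (x i * H i j - x j * H i i) - x i * g i - x j * g j) =
  2 * ((\sum_k x k ^+ 2) * (\sum_k H k k) - (\sum_k \sum_l x k * x l * H k l)
       - (N%:R - 1) * (\sum_k x k * g k)).
Proof.
pose A i j := x i * (x i * H j j - x j * H j i)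
    - x j * (x i * H i j - x j * H i i) - x i * g i - x j * g j.
transitivity (\sum_i (\sum_j A i j - A i i)).
  apply: eq_bigr => i _; rewrite [in RHS](bigD1 i) //= [RHS]addrC addKr.
  by apply: eq_bigl => j; rewrite eq_sym.
rewrite sumrB.
have -> : \sum_i A i i = - 2 * \sum_k x k * g k.
  by rewrite mulr_sumr; apply: eq_bigr => i _; rewrite /A; ring.
have -> : \sum_i \sum_j A i j =
    \sum_i \sum_j (x i ^+ 2 * H j j) + \sum_i \sum_j (x j ^+ 2 * H i i)
    - \sum_i \sum_j (x i * x j * H i j) - \sum_i \sum_j (x j * x i * H j i)
    - \sum_i \sum_(j < N) (x i * g i) - \sum_(i < N) \sum_j (x j * g j).
  rewrite -!(sumrB, big_split) /=; apply: eq_bigr => i _.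
  rewrite -!(sumrB, big_split) /=; apply: eq_bigr => j _.
  by rewrite /A; ring.
have s1 : \sum_i \sum_j (x i ^+ 2 * H j j) = (\sum_k x k ^+ 2) * (\sum_k H k k).
  by rewrite mulr_suml; apply: eq_bigr => i _; rewrite mulr_sumr.
have s2 : \sum_i \sum_j (x j ^+ 2 * H i i) = (\sum_k x k ^+ 2) * (\sum_k H k k).
  by rewrite exchange_big.
have s3 : \sum_i \sum_j (x j * x i * H j i) = \sum_i \sum_j (x i * x j * H i j).
  by rewrite exchange_big.
have s4 : \sum_i \sum_(j < N) (x i * g i) = N%:R * \sum_k x k * g k.
  rewrite mulr_sumr; apply: eq_bigr => i _.
  by rewrite sumr_const card_ord mulr_natl.
have s5 : \sum_(i < N) \sum_j (x j * g j) = N%:R * \sum_k x k * g k.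
  by rewrite exchange_big.
by rewrite s1 s2 s3 s4 s5; ring.
Qed.

(** The weight |x|^g is an exponential e^(g t) along the dilations. *)
Lemma is_deriv2_ray {R : realType} {N : nat} (u : 'rV[R]_N -> R) (g : R) (x : 'rV[R]_N) :
  C2_on [set x | x != 0] u -> x != 0 ->
  is_deriv2 (fun t => enorm (expR t *: x) `^ g * u (expR t *: x))
    (enorm x `^ g * (g * u x + euler u x))
    (enorm x `^ g * (g ^+ 2 * u x + 2 * (g * euler u x) + (hess_radial u x + euler u x))).
Proof.
move=> Cu x0; set W := enorm x `^ g.
have dg : is_deriv2 (fun t : R => expR (g * t)) g (g ^+ 2).
  have h (t : R) : is_derive t (1 : R) (fun t => expR (g * t)) (g * expR (g * t)).
    by apply: is_derive_fun_comp (is_derive_expR _) (is_derive_funZ (is_derive_funId _ erefl) erefl) _; rewrite mulr1 mulrC.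
  apply: (is_deriv2_intro h); first by rewrite mulr0 expR0 mulr1.
  by apply: is_derive_funZ (h 0) _; rewrite mulr0 expR0 mulr1 expr2.
have := is_deriv2Z W (is_deriv2M dg (is_deriv2_scale Cu x0)).
rewrite mulr0 expR0 scale1r !mul1r; apply: is_deriv2_ext => t.
rewrite enormZ ger0_norm ?expR_ge0 // powRM ?expR_ge0 ?enorm_ge0 //.
by rewrite -expRM [t * g]mulrC /W; ring.
Qed.

(** By [sum_rotations] and [is_deriv2_ray] the operator sends |x|^g u to
    |x|^g (g^2 u + |x|^2 Lap u + (2 g - N + 2) x . grad u); the choice of [g] makes the
    coefficient of the gradient equal to [a], so that the equation eliminates all
    derivatives of u. *)
Lemma is_cyl_lap_solution {R : realType} {N : nat} (u : 'rV[R]_N -> R) (x : 'rV[R]_N)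
    (g a b p : R) :
  positive_solution a b p u -> x != 0 -> a = 2 * g - N%:R + 2 ->
  is_cyl_lap (fun y => enorm y `^ g * u y) x
    (g ^+ 2 * (enorm x `^ g * u x)
     - enorm x `^ (b - a + 2 - g * (p - 1)) * (enorm x `^ g * u x) `^ p).
Proof.
move=> sol x0 ag; have [up Cu _ _] := sol.
have e0 : 0 < enorm x by rewrite enorm_gt0.
set W := enorm x `^ g.
pose A i j := (x 0 i * (x 0 i * partial j (partial j u) x - x 0 j * partial i (partial j u) x)
    - x 0 j * (x 0 i * partial j (partial i u) x - x 0 j * partial i (partial i u) x)
    - x 0 i * partial i u x - x 0 j * partial j u x).
exists (fun i j => W * (x 0 i * partial j u x - x 0 j * partial i u x)),
  (fun i j => W * A i j), (W * (g * u x + euler u x)),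
  (W * (g ^+ 2 * u x + 2 * (g * euler u x) + (hess_radial u x + euler u x))).
split.
- move=> i j ij; have := is_deriv2Z W (is_deriv2_rot i j Cu x0).
  by apply: is_deriv2_ext => t; rewrite enorm_rot.
- exact: is_deriv2_ray.
- have sA : \sum_i \sum_(j | i != j) W * A i j =
    W * (2 * (nsq x * (\sum_k partial k (partial k u) x) - hess_radial u x
         - (N%:R - 1) * euler u x)).
    under eq_bigr => i _ do rewrite -mulr_sumr.
    rewrite -mulr_sumr; congr (_ * _).
    exact: (sum_rotations (fun k => x 0 k) (fun k => partial k u x)
      (fun k l => partial l (partial k u) x)).
  rewrite sA.
  have := positive_solution_expand sol x0.
  have -> : enorm x `^ (b - a + 2 - g * (p - 1)) * (W * u x) `^ p =
     W * (enorm x `^ (b - a + 2) * u x `^ p).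
    rewrite powRM ?powR_ge0 // ?ltW // /W -powRrM !mulrA -!powR_add //.
    by congr (_ `^ _ * _); ring.
  move=> h.
  set S := nsq x * _ in h *.
  have -> : S = - (a * euler u x) - enorm x `^ (b - a + 2) * u x `^ p by lra.
  by rewrite ag; field.
Qed.

(** * Annuli, inversions in spheres and radial functions *)
Lemma nsq_continuous {R : realType} {N : nat} : continuous (@nsq R N).
Proof.
move=> x; apply: (cvg_sum_ord (FF := nbhs_filter x)) => k; rewrite expr2.
by under eq_fun do rewrite expr2; apply: (cvgM (FF := nbhs_filter x));
  exact: coord_continuous.
Qed.

Lemma enorm_continuous {R : realType} {N : nat} : continuous (@enorm R N).
Proof.
move=> x; apply: (@continuous_comp _ _ _ (@nsq R N) Num.sqrt).
  exact: nsq_continuous.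
exact: sqrt_continuous.
Qed.

Lemma coord_le_enorm {R : realType} {N : nat} (x : 'rV[R]_N) (k : 'I_N) :
  `|x 0 k| <= enorm x.
Proof.
rewrite -sqrtr_sqr; apply: ler_wsqrtr.
rewrite -/(nsq x) /nsq (bigD1 k) //= lerDl.
by apply: sumr_ge0 => i _; exact: sqr_ge0.
Qed.

Definition annulus {R : realType} {N : nat} (r s : R) : set 'rV[R]_N :=
  [set x | r <= enorm x <= s].

(** Minima are sought on closed annuli: these are the compact sets of the cylinder
    that are invariant under rotations. *)
Lemma annulus_compact {R : realType} {N : nat} (r s : R) :
  compact (@annulus R N r s).
Proof.
apply: bounded_closed_compact.
  exists s; split; first exact: num_real.
  move=> M sM x /andP[_ xs].
  have M0 : 0 <= M by rewrite (le_trans (enorm_ge0 x)) // (le_trans xs) // ltW.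
  change (mx_norm x <= M); rewrite mx_normrE; apply/bigmax_leP; split => // -[i j] _ /=.
  rewrite ord1 (le_trans (coord_le_enorm x j)) // (le_trans xs) //; exact: ltW.
have -> : @annulus R N r s = @enorm R N @^-1` [set t | r <= t] `&` @enorm R N @^-1` [set t | t <= s].
  by apply/seteqP; split => x /=; rewrite /annulus /= => /andP.
apply: closedI; (apply: closed_comp; first by move=> x _; exact: enorm_continuous).
  exact: closed_ge.
exact: closed_le.
Qed.

Lemma annulus_min {R : realType} {N : nat} (r s : R) (f : 'rV[R]_N -> R) :
  0 < r -> (forall x, x != 0 -> {for x, continuous f}) ->
  @annulus R N r s !=set0 ->
  exists2 x, annulus r s x & forall y, annulus r s y -> f x <= f y.
Proof.
move=> r0 cf ne.
have ct : {within annulus r s, continuous f}.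
  apply: continuous_in_subspaceT => x; rewrite inE => /andP[rx _].
  by apply: cf; rewrite -enorm_gt0 (lt_le_trans r0).
have [x] := EVT_min_rV ne (@annulus_compact _ _ r s) ct.
rewrite inE => Kx h; exists x => // y Ky; apply: h; exact: mem_set.
Qed.

Lemma annulus_near {R : realType} {N : nat} (r s : R) (x : 'rV[R]_N) :
  r < enorm x < s -> nbhs x (fun y : 'rV[R]_N => r < enorm y < s).
Proof.
move=> /andP[rx xs].
have h1 : nbhs x (fun y : 'rV[R]_N => r < enorm y).
  by apply: (cvgr_gt (FF := nbhs_filter x) (enorm x)) => //; exact: enorm_continuous.
have h2 : nbhs x (fun y : 'rV[R]_N => enorm y < s).
  by apply: (cvgr_lt (FF := nbhs_filter x) (enorm x)) => //; exact: enorm_continuous.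
by near=> y; apply/andP; split; near: y.
Unshelve. all: by end_near. Qed.

Definition sphere_inv {R : realType} {N : nat} (lam : R) (x : 'rV[R]_N) : 'rV[R]_N :=
  (lam ^+ 2 / nsq x) *: x.

Lemma sphere_inv_rot {R : realType} {N : nat} (lam : R) (i j : 'I_N) (t : R) (x : 'rV[R]_N) :
  i != j -> sphere_inv lam (rot i j t x) = rot i j t (sphere_inv lam x).
Proof. by move=> ij; rewrite /sphere_inv nsq_rot // rotZ. Qed.

Lemma sphere_inv_scale {R : realType} {N : nat} (lam t : R) (x : 'rV[R]_N) :
  x != 0 -> sphere_inv lam (expR t *: x) = expR (- t) *: sphere_inv lam x.
Proof.
move=> x0; have n0 : nsq x != 0 by rewrite gt_eqF // nsq_gt0.
rewrite /sphere_inv nsqZ !scalerA; congr (_ *: _); rewrite expRN.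
by field; rewrite n0 gt_eqF ?expR_gt0.
Qed.

Lemma enorm_sphere_inv {R : realType} {N : nat} (lam : R) (x : 'rV[R]_N) :
  x != 0 -> enorm (sphere_inv lam x) = lam ^+ 2 / enorm x.
Proof.
move=> x0; have e0 : enorm x != 0 by rewrite gt_eqF // enorm_gt0.
rewrite enormZ ger0_norm; last by rewrite divr_ge0 ?sqr_ge0 ?nsq_ge0.
by rewrite -sqr_enorm; field.
Qed.

Lemma sphere_inv_neq0 {R : realType} {N : nat} (lam : R) (x : 'rV[R]_N) :
  0 < lam -> x != 0 -> sphere_inv lam x != 0.
Proof.
by move=> l0 x0; rewrite -enorm_gt0 enorm_sphere_inv // divr_gt0 ?exprn_gt0 // enorm_gt0.
Qed.

Lemma sphere_inv_fixed {R : realType} {N : nat} (lam : R) (x : 'rV[R]_N) :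
  0 < lam -> enorm x = lam -> sphere_inv lam x = x.
Proof.
move=> l0 xl; rewrite /sphere_inv -sqr_enorm xl divff ?scale1r //.
by rewrite gt_eqF // exprn_gt0.
Qed.

(** Inversions commute with rotations and reverse dilations, and a second derivative
    does not see the reversal. *)
Lemma is_cyl_lap_inv {R : realType} {N : nat} (lam : R) (f : 'rV[R]_N -> R)
    (x : 'rV[R]_N) (L : R) :
  x != 0 -> is_cyl_lap f (sphere_inv lam x) L -> is_cyl_lap (fun y => f (sphere_inv lam y)) x L.
Proof.
move=> x0 [dA [A [d [B [hA hB ->]]]]].
exists dA, A, (- d), B; split => //.
  move=> i j ij; apply: (is_deriv2_ext _ (hA i j ij)) => t.
  by rewrite sphere_inv_rot.
by apply: (is_deriv2_ext _ (is_deriv2_opp hB)) => t; rewrite sphere_inv_scale.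
Qed.

Lemma is_cyl_lap_radial {R : realType} {N : nat} (G G' : R -> R) (l : R) (x : 'rV[R]_N) :
  x != 0 ->
  (forall t, is_derive t (1 : R) G (G' t)) ->
  is_derive (ln (enorm x)) (1 : R) G' l ->
  is_cyl_lap (fun y => G (ln (enorm y))) x l.
Proof.
move=> x0 dG dG'; have e0 : 0 < enorm x by rewrite enorm_gt0.
exists (fun _ _ => 0), (fun _ _ => 0), (G' (ln (enorm x))), l; split.
- move=> i j ij; apply: (@is_deriv2_ext _ (fun=> G (ln (enorm x)))).
    by move=> t; rewrite enorm_rot.
  by apply: (is_deriv2_intro (g' := fun=> 0)) => // [s|]; exact: is_derive_funC.
- have sh (c t : R) : is_derive t (1 : R) (fun t => t + c) 1.
    by apply: is_derive_funD (is_derive_funId _ erefl) (is_derive_funC _ _ erefl) _; rewrite addr0.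
  apply: (@is_deriv2_ext _ (fun t => G (t + ln (enorm x)))).
    move=> t; rewrite enormZ ger0_norm ?expR_ge0 // lnM ?posrE ?expR_gt0 //.
    by rewrite expRK.
  apply: (is_deriv2_intro (g' := fun t => G' (t + ln (enorm x)))).
  + by move=> t; apply: is_derive_fun_comp (dG _) (sh _ t) _; rewrite mulr1.
  + by rewrite add0r.
  + by apply: (@is_derive_fun_comp _ G' _ 0 l 1 _ _ (sh _ _)); rewrite ?add0r ?mulr1.
- by rewrite big1 ?mul0r ?add0r // => i _; rewrite big1.
Qed.

Lemma is_cyl_lap_power {R : realType} {N : nat} (g c : R) (x : 'rV[R]_N) :
  x != 0 -> is_cyl_lap (fun y => c * expR (g * ln (enorm y))) x
     (g ^+ 2 * (c * expR (g * ln (enorm x)))).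
Proof.
move=> x0.
have h (c' t : R) : is_derive t (1 : R) (fun t => c' * expR (g * t)) (g * c' * expR (g * t)).
  apply: is_derive_funZ (is_derive_fun_comp (is_derive_expR _) (is_derive_funZ (is_derive_funId _ erefl) erefl) erefl) _.
  by rewrite mulr1; ring.
apply: (is_cyl_lap_radial x0 (h c)).
by apply: (is_derive_eq (h (g * c) _)); ring.
Qed.

(** The mean value theorem, the derivative of the power being largest at [z]. *)
Lemma powR_tangent {R : realType} (p y z : R) : 1 <= p -> 0 <= y -> y <= z -> 0 < z ->
  z `^ p - y `^ p <= p * z `^ (p - 1) * (z - y).
Proof.
move=> p1 y0 yz z0; have p0 : 0 < p by rewrite (lt_le_trans ltr01).
have [y_eq0|yp] := eqVneq y 0.
  have E : z `^ (p - 1) * z = z `^ p by rewrite mulrC mulr_powRB1 // ltW.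
  by rewrite y_eq0 powR0 ?gt_eqF // !subr0 -mulrA E ler_peMl // powR_ge0.
have {}y0 : 0 < y by rewrite lt_neqAle eq_sym yp.
have d (t : R) : 0 < t -> is_derive t (1 : R) (fun s => s `^ p) (p * t `^ (p - 1)).
  by move=> t0; exact: is_derive1_powR.
have [||c] := @MVT_segment _ (fun s => s `^ p) (fun t => p * t `^ (p - 1)) y z yz.
- by move=> t; rewrite in_itv /= => /andP[yt _]; apply: d; exact: lt_trans yt.
- apply: derivable_within_continuous => t; rewrite in_itv/= => /andP[yt _].
  by apply: (@ex_derive _ _ _ _ _ _ _ (d t (lt_le_trans y0 yt))).
rewrite in_itv /= => /andP[yc cz] ->.
have c0 : 0 < c := lt_le_trans y0 yc.
rewrite ler_wpM2r ?subr_ge0 // ler_wpM2l //; first exact: ltW.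
have := @ge0_ler_powR R (p - 1); rewrite subr_ge0 => /(_ p1).
by apply; rewrite // nnegrE ltW.
Qed.

(** * Comparison of a solution with its reflection *)
Lemma sphere_inv_cvg {R : realType} {N : nat} {T : Type} (F : set_system T) {FF : Filter F}
    (m : T -> R) (y : T -> 'rV[R]_N) (m0 : R) (y0 : 'rV[R]_N) :
  y0 != 0 -> m @ F --> m0 -> y @ F --> y0 ->
  (fun t => sphere_inv (m t) (y t)) @ F --> sphere_inv m0 y0.
Proof.
move=> ne hm hy; apply: cvgZ => //; apply: cvgM.
  by rewrite expr2; under eq_fun do rewrite expr2; exact: cvgM.
apply: cvgV; first by rewrite gt_eqF // nsq_gt0.
by apply: cvg_comp hy _; exact: nsq_continuous.
Qed.

(** What the moving sphere method uses of the function [w] that a solution gives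
    rise to: its equation on the cylinder, its derivative [wd] along dilations, its
    decay at the origin and the smallness there of the linearised nonlinearity. *)
Definition cyl_solution {R : realType} {N : nat} (g del p : R)
    (w wd : 'rV[R]_N -> R) : Prop :=
  [/\ forall x, x != 0 -> 0 < w x /\ {for x, continuous w},
      forall x, x != 0 -> is_cyl_lap w x (g ^+ 2 * w x - enorm x `^ del * w x `^ p),
      forall x, x != 0 -> is_derive (0 : R) (1 : R) (fun t => w (expR t *: x)) (wd x)
                          /\ {for x, continuous wd},
      forall e, 0 < e -> exists2 r, 0 < r & forall x, x != 0 -> enorm x <= r -> w x < e
    & exists2 r, 0 < r & forall x, x != 0 -> enorm x <= r ->
        p * (enorm x `^ del * w x `^ (p - 1)) < g ^+ 2].

Definition reflects {R : realType} {N : nat} (w : 'rV[R]_N -> R) (lam : R) : Prop :=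
  forall x, x != 0 -> enorm x <= lam -> w x <= w (sphere_inv lam x).

Lemma continuous_refl_diff {R : realType} {N : nat} (w : 'rV[R]_N -> R) (lam : R) :
  0 < lam -> (forall x, x != 0 -> {for x, continuous w}) ->
  forall x, x != 0 -> {for x, continuous (fun y => w (sphere_inv lam y) - w y)}.
Proof.
move=> l0 cw x x0; apply: (cvgB (FF := nbhs_filter x)); last exact: cw.
apply: (@cvg_comp _ _ _ (sphere_inv lam) w _ (nbhs (sphere_inv lam x))); last by apply: cw; exact: sphere_inv_neq0.
apply: (sphere_inv_cvg (FF := nbhs_filter x)) => //; exact: cvg_cst.
Qed.

Lemma enorm_le_inv {R : realType} {N : nat} (lam : R) (x : 'rV[R]_N) :
  x != 0 -> enorm x <= lam -> lam <= enorm (sphere_inv lam x).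
Proof.
move=> x0 xl; have e0 : 0 < enorm x by rewrite enorm_gt0.
rewrite enorm_sphere_inv // ler_pdivlMr // expr2; apply: ler_wpM2l => //.
exact: le_trans (ltW e0) xl.
Qed.

Lemma enorm_lt_inv {R : realType} {N : nat} (lam : R) (x : 'rV[R]_N) :
  x != 0 -> enorm x < lam -> lam < enorm (sphere_inv lam x).
Proof.
move=> x0 xl; have e0 : 0 < enorm x by rewrite enorm_gt0.
rewrite enorm_sphere_inv // ltr_pdivlMr // expr2 ltr_pM2l //.
exact: lt_trans e0 xl.
Qed.

Lemma le_powR {R : realType} (d y z : R) : 0 <= d -> 0 < y -> y <= z -> y `^ d <= z `^ d.
Proof.
move=> d0 y0 yz; apply: ge0_ler_powR => //; rewrite nnegrE ltW //.
exact: lt_le_trans yz.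
Qed.

Lemma lt_powR {R : realType} (d y z : R) : 0 < d -> 0 < y -> y < z -> y `^ d < z `^ d.
Proof.
move=> d0 y0 yz; apply: gt0_ltr_powR => //; rewrite nnegrE ltW //.
exact: lt_trans yz.
Qed.

(** Where p |x|^d w^(p-1) < g^2 the linearised equation satisfies a maximum principle,
    so the comparison can only fail outside the ball of radius [r0]. *)
Lemma reflects_from_outer {R : realType} {N : nat} (g del p : R)
    (w wd : 'rV[R]_N -> R) (r0 lam : R) :
  1 < p -> 0 < del -> cyl_solution g del p w wd ->
  0 < r0 -> (forall x, x != 0 -> enorm x <= r0 ->
        p * (enorm x `^ del * w x `^ (p - 1)) < g ^+ 2) ->
  0 < lam ->
  (forall x, x != 0 -> r0 <= enorm x <= lam -> w x <= w (sphere_inv lam x)) ->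
  reflects w lam.
Proof.
move=> p1 d0 [wp weq _ wlim _] r00 small l0 outer x1 x10 x1l.
rewrite leNgt; apply/negP => bad.
pose v y := w (sphere_inv lam y) - w y.
have cv y : y != 0 -> {for y, continuous v}.
  by apply: continuous_refl_diff => // z /wp[].
have [r1' r1'0 hr1] := wlim (- v x1) ltac:(by rewrite /v; lra).
(* below this radius w is too small for v to be as negative as at x1 *)
pose r1 := Num.min r1' (enorm x1).
have e1 : 0 < enorm x1 by rewrite enorm_gt0.
have r10 : 0 < r1 by rewrite lt_min r1'0.
have r1x1 : r1 <= enorm x1 by rewrite ge_min lexx orbT.
have r1r1' : r1 <= r1' by rewrite ge_min lexx.
pose m := Num.min r0 lam.
have ml : m <= lam by rewrite ge_min lexx orbT.
have mr : m <= r0 by rewrite ge_min lexx.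
have x1m : enorm x1 <= m.
  rewrite le_min x1l andbT leNgt; apply/negP => h.
  have := outer x1 x10; rewrite x1l (ltW h) /= => /(_ isT).
  by rewrite leNgt bad.
have K1 : annulus r1 m x1 by rewrite /annulus /= r1x1.
have [x2 K2 min2] := annulus_min r10 cv (ex_intro _ x1 K1).
have v2 : v x2 <= v x1 by exact: min2.
move: (K2) => /andP[r1x2 x2m].
have x20 : x2 != 0 by rewrite -enorm_gt0 (lt_le_trans r10).
have v20 : v x2 < 0 by rewrite (le_lt_trans v2) // /v subr_lt0.
have w2 := (wp x2 x20).1.
have ws2 : 0 < w (sphere_inv lam x2) by apply: (wp _ _).1; exact: sphere_inv_neq0.
have lt2 : r1 < enorm x2 < m.
  apply/andP; split.
    rewrite lt_neqAle r1x2 andbT; apply/eqP => h.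
    have := hr1 x2 x20; rewrite -h => /(_ r1r1').
    by apply/negP; rewrite -leNgt; move: v2 ws2; rewrite /v; lra.
  rewrite lt_neqAle x2m andbT; apply/eqP => h.
  have : w x2 <= w (sphere_inv lam x2); last by move: v20; rewrite /v; lra.
  move: h; rewrite /m minEle; case: ifP => _ h.
    by apply: outer => //; rewrite h lexx -h (le_trans x2m).
  by rewrite sphere_inv_fixed.
have locmin : \forall y \near x2, v x2 <= v y.
  apply: filterS (annulus_near lt2) => y /andP[h1 h2]; apply: min2.
  by rewrite /annulus /= !ltW.
have x2l : enorm x2 <= lam := le_trans x2m ml.
have := is_cyl_lap_min (is_cyl_lapB (is_cyl_lap_inv x20 (weq _ (sphere_inv_neq0 l0 x20))) (weq _ x20)) locmin.
have sm := small x2 x20 (le_trans x2m mr).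
have e2 : 0 < enorm x2 by rewrite enorm_gt0.
have hd : enorm x2 `^ del <= enorm (sphere_inv lam x2) `^ del.
  by apply: le_powR => //; [exact: ltW|rewrite (le_trans x2l) // enorm_le_inv].
have wl : w (sphere_inv lam x2) <= w x2 by move: v20; rewrite /v; lra.
have tang := powR_tangent (ltW p1) (ltW ws2) wl w2.
have q0 : 0 <= w (sphere_inv lam x2) `^ p := powR_ge0 _ _.
have E0 : 0 <= enorm x2 `^ del := powR_ge0 _ _.
have h1 : enorm x2 `^ del * w (sphere_inv lam x2) `^ p <=
   enorm (sphere_inv lam x2) `^ del * w (sphere_inv lam x2) `^ p by rewrite ler_wpM2r.
have h2 := ler_wpM2l E0 tang.
have h3 : 0 < w x2 - w (sphere_inv lam x2) by move: v20; rewrite /v; lra.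
(* the smallness condition at x2, against which the equation fails *)
have h4 : p * (enorm x2 `^ del * w x2 `^ (p - 1)) * (w x2 - w (sphere_inv lam x2))
   < g ^+ 2 * (w x2 - w (sphere_inv lam x2)) by rewrite ltr_pM2r.
apply/negP; rewrite -ltNge.
move: h1 h2 h4.
set a1 := enorm x2 `^ del; set a2 := enorm (sphere_inv lam x2) `^ del.
set P := w x2 `^ p; set Q := w (sphere_inv lam x2) `^ p; set Y := w x2 `^ (p - 1).
set W := w x2; set V := w (sphere_inv lam x2).
have -> : a1 * (p * Y * (W - V)) = p * (a1 * Y) * (W - V) by ring.
rewrite (mulrBr a1) (mulrBr (g ^+ 2)).
by set Z := p * (a1 * Y) * _; lra.
Qed.

(** A point of equality would be a minimum of the difference, where the operator is
    nonnegative; but the equations of w and of its reflection differ there by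
    (|x|^d - |x'|^d) w^p, which is negative because the reflected point x' is farther
    from the origin and d > 0. *)
Lemma reflects_strict {R : realType} {N : nat} (g del p : R)
    (w wd : 'rV[R]_N -> R) (lam : R) :
  0 < del -> cyl_solution g del p w wd ->
  0 < lam -> reflects w lam ->
  forall x, x != 0 -> enorm x < lam -> w x < w (sphere_inv lam x).
Proof.
move=> d0 [wp weq _ _ _] l0 good x x0 xl.
rewrite lt_neqAle good ?(ltW xl) // andbT; apply/eqP => eqw.
have e0 : 0 < enorm x by rewrite enorm_gt0.
have locmin : \forall y \near x, w (sphere_inv lam x) - w x <= w (sphere_inv lam y) - w y.
  have lt1 : 0 < enorm x < lam by rewrite e0.
  apply: filterS (annulus_near lt1) => y /andP[y0 yl].
  rewrite -eqw subrr subr_ge0; apply: good; last exact: ltW.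
  by rewrite -enorm_gt0.
have := is_cyl_lap_min (is_cyl_lapB (is_cyl_lap_inv x0 (weq _ (sphere_inv_neq0 l0 x0))) (weq _ x0)) locmin.
rewrite -eqw; apply/negP; rewrite -ltNge.
have : enorm x `^ del < enorm (sphere_inv lam x) `^ del.
  by apply: lt_powR => //; rewrite (lt_trans xl) // enorm_lt_inv.
have [wx _] := wp x x0.
have : 0 < w x `^ p by rewrite powR_gt0.
set W := w x `^ p; move=> W0 h.
have : enorm x `^ del * W < enorm (sphere_inv lam x) `^ del * W by rewrite ltr_pM2r.
lra.
Qed.

(** * The radial derivative on the reflecting sphere *)
Lemma derive_right_ge0 {R : realType} (f : R -> R) (l e : R) :
  is_derive (0 : R) (1 : R) f l -> f 0 = 0 -> 0 < e ->
  (forall t, 0 < t < e -> 0 <= f t) -> 0 <= l.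
Proof.
move=> /is_derive1_caratheodory[k [fE kc <-]] f0 e0 fp.
rewrite leNgt; apply/negP => k0.
have /nbhs_ballP[r /= r0 hr] : \forall s \near (0 : R), k s < 0 by apply: (cvgr_lt _ kc).
pose t := Num.min e r / 2.
have m0 : 0 < Num.min e r by rewrite lt_min e0 r0.
have me : Num.min e r <= e by rewrite ge_min lexx.
have mr : Num.min e r <= r by rewrite ge_min lexx orbT.
have t0 : 0 < t by rewrite /t; lra.
have kt : k t < 0.
  by apply: hr; rewrite /ball /= sub0r normrN gtr0_norm // /t; lra.
have := fp t; rewrite t0 /= => /(_ ltac:(rewrite /t; lra)).
have := fE t; rewrite f0 !subr0 => ->.
by apply/negP; rewrite -ltNge pmulr_llt0.
Qed.

(** The function v, the reflected w minus w, is nonnegative inside the sphere and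
    vanishes on it. The radial barrier h = ep (e^(g s) - e^(-g s)), with
    s = ln lam - ln |x|, satisfies the linear equation h_tt = g^2 h exactly, vanishes on
    the sphere and lies below v on the sphere of half the radius; hence it lies
    below v in between, and its inward slope 2 ep g bounds that of v, which is
    twice [wd]. *)
Lemma reflects_hopf {R : realType} {N : nat} (g del p : R)
    (w wd : 'rV[R]_N -> R) (lam : R) (x : 'rV[R]_N) :
  0 < g -> 1 < p -> 0 < del -> cyl_solution g del p w wd ->
  0 < lam -> reflects w lam -> enorm x = lam -> 0 < wd x.
Proof.
move=> g0 p1 d0 S l0 good xl; have [wp weq wder _ _] := S.
have x0 : x != 0 by rewrite -enorm_gt0 xl.
pose v y := w (sphere_inv lam y) - w y.
have cv y : y != 0 -> {for y, continuous v}.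
  by apply: continuous_refl_diff => // z /wp[].
have l20 : 0 < lam / 2 by lra.
have neh : @annulus R N (lam / 2) (lam / 2) !=set0.
  exists (2^-1 *: x); rewrite /annulus /= enormZ gtr0_norm ?invr_gt0 // xl.
  by rewrite mulrC lexx.
have [x1 /andP[x1a x1b] min1] := annulus_min l20 cv neh.
have x1e : enorm x1 = lam / 2 by apply/eqP; rewrite eq_le x1a x1b.
have x10 : x1 != 0 by rewrite -enorm_gt0 x1e.
have v1 : 0 < v x1.
  by rewrite subr_gt0; apply: (reflects_strict d0 S) => //; rewrite x1e; lra.
have ln2 : 0 < ln (2 : R) by rewrite ln_gt0 // ltr1n.
have C0 : 0 < expR (g * ln 2) - expR (- g * ln 2).
  by rewrite subr_gt0 ltr_expR ltr_pM2r // gtrN.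
pose ep := v x1 / (expR (g * ln 2) - expR (- g * ln 2)).
have ep0 : 0 < ep by rewrite divr_gt0.
(* ep is such that h equals the minimum of v where |x| = lam / 2 *)
pose c1 := ep * expR (g * ln lam); pose c2 := ep * expR (- g * ln lam).
pose h (y : 'rV[R]_N) := c1 * expR (- g * ln (enorm y)) - c2 * expR (g * ln (enorm y)).
have hE (y : 'rV[R]_N) : h y = ep * (expR (g * (ln lam - ln (enorm y)))
     - expR (- g * (ln lam - ln (enorm y)))).
  have -> : g * (ln lam - ln (enorm y)) = g * ln lam + - g * ln (enorm y) by ring.
  have -> : - g * (ln lam - ln (enorm y)) = - g * ln lam + g * ln (enorm y) by ring.
  by rewrite !expRD /h /c1 /c2; ring.
have hcyl y : y != 0 -> is_cyl_lap h y (g ^+ 2 * h y).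
  move=> y0; have := is_cyl_lapB (is_cyl_lap_power (- g) c1 y0) (is_cyl_lap_power g c2 y0).
  by rewrite sqrrN -mulrBr.
have hcont y : y != 0 -> {for y, continuous h}.
  move=> y0; have lc : (fun z : 'rV[R]_N => ln (enorm z)) @ y --> ln (enorm y).
    apply: (@cvg_comp _ _ _ _ (@ln R) _ (nbhs (enorm y))); first exact: enorm_continuous.
    by apply: continuous_ln; rewrite enorm_gt0.
  have ec c k : (fun z : 'rV[R]_N => c * expR (k * ln (enorm z))) @ y -->
      c * expR (k * ln (enorm y)).
    apply: (cvgMl_tmp (FF := nbhs_filter y)).
    apply: (@cvg_comp _ _ _ (fun z => k * ln (enorm z)) (@expR R) _ (nbhs (k * ln (enorm y)))).
      exact: (cvgMl_tmp (FF := nbhs_filter y)).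
    exact: continuous_expR.
  exact: (cvgB (FF := nbhs_filter y)).
have barrier y : lam / 2 <= enorm y <= lam -> h y <= v y.
  move=> Ky; pose z y := v y - h y.
  have cz y' : y' != 0 -> {for y', continuous z}.
    by move=> y'0; apply: (cvgB (FF := nbhs_filter y')); [exact: cv|exact: hcont].
  have [x2 K2 min2] := annulus_min l20 cz (ex_intro _ y Ky).
  rewrite -subr_ge0; apply: le_trans (min2 _ Ky).
  move: (K2) => /andP[x2a x2b].
  have x20 : x2 != 0 by rewrite -enorm_gt0 (lt_le_trans l20).
  have [x2l|x2l] := eqVneq (enorm x2) lam.
    by rewrite /z hE x2l subrr !mulr0 subrr mulr0 subr0 /v sphere_inv_fixed // subrr.
  have [x2h|x2h] := eqVneq (enorm x2) (lam / 2).
    rewrite /z subr_ge0 hE x2h ln_div ?posrE // subKr /ep divfK ?gt_eqF //.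
    by apply: min1; rewrite /annulus /= x2h lexx.
  rewrite leNgt; apply/negP => z0.
  have lt2 : lam / 2 < enorm x2 < lam by rewrite !lt_neqAle x2a x2b x2l eq_sym x2h.
  have locmin : \forall y \near x2, z x2 <= z y.
    apply: filterS (annulus_near lt2) => t /andP[h1 h2]; apply: min2.
    by rewrite /annulus /= !ltW.
  have := is_cyl_lap_min (is_cyl_lapB (is_cyl_lapB (is_cyl_lap_inv x20 (weq _ (sphere_inv_neq0 l0 x20)))
     (weq _ x20)) (hcyl _ x20)) locmin.
  apply/negP; rewrite -ltNge.
  have wle := good x2 x20 x2b.
  have e2 : 0 < enorm x2 by rewrite enorm_gt0.
  have w2 := (wp x2 x20).1.
  have h1 : enorm x2 `^ del * w x2 `^ p <=
      enorm (sphere_inv lam x2) `^ del * w (sphere_inv lam x2) `^ p.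
    apply: ler_pM; rewrite ?powR_ge0 //.
      by apply: le_powR => //; [exact: ltW|rewrite (le_trans x2b) // enorm_le_inv].
    by apply: le_powR => //; lra.
  have h2 : g ^+ 2 * (w (sphere_inv lam x2) - w x2 - h x2) < 0.
    by rewrite pmulr_rlt0 ?exprn_gt0.
  move: h1 h2; rewrite !mulrBr; set A1 := _ `^ del * _; set A2 := _ `^ del * _.
  lra.
have wdx := (wder x x0).1.
have wdN : is_derive (0 : R) (1 : R) (fun t => w (expR (- t) *: x)) (- wd x).
  have h0 : is_derive (- 0 : R) (1 : R) (fun t => w (expR t *: x)) (wd x) by rewrite oppr0.
  have hN := is_derive_funN (is_derive_funId (0 : R) erefl) erefl.
  by apply: (is_derive_eq (is_derive_fun_comp h0 hN erefl)); rewrite mulrN1.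
have dexp (k : R) : is_derive (0 : R) (1 : R) (fun t => expR (k * t)) k.
  apply: is_derive_fun_comp (is_derive_expR _) (is_derive_funZ (is_derive_funId _ erefl) erefl) _.
  by rewrite mulr0 expR0 mul1r mulr1.
have dphi := is_derive_funB (is_derive_funB wdx wdN erefl)
  (is_derive_funZ (is_derive_funB (dexp g) (dexp (- g)) erefl) (erefl (ep * _))) erefl.
have := derive_right_ge0 dphi _ ln2 _.
rewrite !mulr0 oppr0 expR0 !subrr mulr0 subrr => /(_ erefl) H.
suff : 0 <= wd x - - wd x - ep * (g - - g).
  have : 0 < ep * g by rewrite mulr_gt0.
  by lra.
apply: H => t /andP[t0 tl].
have := barrier (expR (- t) *: x).
rewrite enormZ gtr0_norm ?expR_gt0 // xl => /(_ _).
rewrite hE enormZ gtr0_norm ?expR_gt0 // xl lnM ?posrE ?expR_gt0 // expRK.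
rewrite /v sphere_inv_scale // opprK sphere_inv_fixed //.
have -> : ln lam - (- t + ln lam) = t by ring.
have h1 : expR (- t) <= 1 by rewrite expR_le1; lra.
have h2 : 2^-1 <= expR (- t).
  by rewrite -(@lnK R 2^-1) ?posrE ?invr_gt0 // ler_expR lnV ?posrE // lerN2 ltW.
have -> : lam / 2 <= expR (- t) * lam <= lam by apply/andP; split; nra.
move=> /(_ isT); lra.
Qed.

(** * Moving the sphere to infinity *)
Lemma is_derive_ray {R : realType} {N : nat} (w wd : 'rV[R]_N -> R) (x : 'rV[R]_N) (s : R) :
  (forall x, x != 0 -> is_derive (0 : R) (1 : R) (fun t => w (expR t *: x)) (wd x)) ->
  x != 0 -> is_derive s (1 : R) (fun t => w (expR t *: x)) (wd (expR s *: x)).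
Proof.
move=> dw x0.
have sx0 : expR s *: x != 0 by rewrite scaler_eq0 negb_or x0 gt_eqF ?expR_gt0.
have -> : (fun t => w (expR t *: x)) = (fun t => w (expR (t - s) *: (expR s *: x))).
  by apply/funext => t; rewrite scalerA -expRD subrK.
have h0 : is_derive (s - s : R) (1 : R) (fun t => w (expR t *: (expR s *: x)))
    (wd (expR s *: x)) by rewrite subrr; exact: dw.
have hs := is_derive_funB (is_derive_funId s erefl) (is_derive_funC s s erefl) erefl.
by apply: (is_derive_eq (@is_derive_fun_comp _ _ (fun t => t - s) s _ _ _ h0 hs erefl)); rewrite subr0 mulr1.
Qed.

(** Local form of the continuation step, to be made uniform by compactness of an
    annulus. Outside the sphere there is nothing to prove for m close to lam; inside,
    strict inequality persists by continuity; near the sphere itself, y and its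
    reflection are joined by a short piece of a ray along which w increases. *)
Lemma reflects_near {R : realType} {N : nat} (g del p : R)
    (w wd : 'rV[R]_N -> R) (lam : R) (x : 'rV[R]_N) :
  0 < g -> 1 < p -> 0 < del -> cyl_solution g del p w wd ->
  0 < lam -> reflects w lam -> x != 0 ->
  \forall y \near x & m \near lam, lam < m -> enorm y <= m -> w y <= w (sphere_inv m y).
Proof.
move=> g0 p1 d0 S l0 good x0; have [wp weq wder _ _] := S.
have [xl|xl|xl] := ltgtP (enorm x) lam.
- have cv : (fun z : 'rV[R]_N * R => w (sphere_inv z.2 z.1) - w z.1) @ (x, lam) -->
      w (sphere_inv lam x) - w x.
    apply: (cvgB (FF := nbhs_filter (x, lam))); last first.
      by apply: (@cvg_comp _ _ _ (@fst _ _) w _ (nbhs x)); [exact: cvg_fst|exact: (wp x x0).2].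
    apply: (@cvg_comp _ _ _ (fun z => sphere_inv z.2 z.1) w _ (nbhs (sphere_inv lam x))).
      by apply: (sphere_inv_cvg (FF := nbhs_filter (x, lam))) => //; [exact: cvg_snd|exact: cvg_fst].
    by apply: (wp _ _).2; exact: sphere_inv_neq0.
  have v0 : 0 < w (sphere_inv lam x) - w x.
    by rewrite subr_gt0; exact: (reflects_strict d0 S).
  have := cvgr_gt (FF := nbhs_filter (x, lam)) _ cv _ v0.
  move=> [AB hAB sAB]; exists AB => // z /sAB /=.
  by rewrite subr_gt0 => /ltW.
(* y stays outside the sphere of radius m, so the claim is void *)
- pose mid := (lam + enorm x) / 2.
  exists ([set y : 'rV[R]_N | mid < enorm y], [set m : R | m < mid]); last first.
    move=> [y m] /= [h1 h2] _ ym; exfalso.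
    by have := lt_trans h2 (lt_le_trans h1 ym); rewrite ltxx.
  split => /=.
    have xm : mid < enorm x < enorm x + 1 by rewrite /mid; apply/andP; split; lra.
    by apply: filterS (annulus_near xm) => y /andP[].
  by apply: lt_nbhsl; rewrite /mid; lra.
- have wdx := reflects_hopf g0 p1 d0 S l0 good xl.
  have cwd : (fun z : 'rV[R]_N * R => wd (expR z.2 *: z.1)) @ (x, 0 : R) --> wd x.
    apply: (@cvg_comp _ _ _ (fun z : 'rV[R]_N * R => expR z.2 *: z.1) wd _ (nbhs x)).
      have := @cvgZ _ _ _ _ (nbhs_filter (x, 0 : R)) (fun z => expR z.2) (fun z => z.1) (expR 0) x.
      rewrite expR0 scale1r; apply; last exact: cvg_fst.
      apply: (@cvg_comp _ _ _ (@snd _ _) (@expR R) _ (nbhs (0 : R))); first exact: cvg_snd.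
      by rewrite -expR0; exact: continuous_expR.
    exact: (wder x x0).2.
  have [[A B] /= [nA nB] sAB] := cvgr_gt (FF := nbhs_filter (x, 0 : R)) _ cwd _ wdx.
  have /nbhs_ballP[eta /= eta0 sB] := nB.
  have cs : (fun z : 'rV[R]_N * R => 2 * (ln z.2 - ln (enorm z.1))) @ (x, lam) --> (0 : R).
    have -> : (0 : R) = 2 * (ln lam - ln (enorm x)) by rewrite xl subrr mulr0.
    apply: (cvgMl_tmp (FF := nbhs_filter (x, lam))); apply: (cvgB (FF := nbhs_filter (x, lam))).
      apply: (@cvg_comp _ _ _ (@snd _ _) (@ln R) _ (nbhs lam)); first exact: cvg_snd.
      exact: continuous_ln.
    apply: (@cvg_comp _ _ _ (@enorm R N \o fst) (@ln R) _ (nbhs (enorm x))).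
      apply: (@cvg_comp _ _ _ (@fst _ _) (@enorm R N) _ (nbhs x)); first exact: cvg_fst.
      exact: enorm_continuous.
    by apply: continuous_ln; rewrite xl.
  have [[A' B'] /= [nA' nB'] sAB'] := cvgr_lt (FF := nbhs_filter (x, lam)) _ cs _ eta0.
  exists (A `&` (A' `&` [set y : 'rV[R]_N | 0 < enorm y]), B').
    split => //=; apply: filterI => //; apply: filterI => //.
    have xm : 0 < enorm x < enorm x + 1 by apply/andP; split; lra.
    by apply: filterS (annulus_near xm) => y /andP[].
  move=> [y m] /= [[Ay [A'y e0]] B'm] lm ym.
  have y0 : y != 0 by rewrite -enorm_gt0.
  have m0 : 0 < m by exact: lt_trans lm.
  (* the reflection of y is e^s y, and s is small *)
  pose s := 2 * (ln m - ln (enorm y)).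
  have s0 : 0 <= s by rewrite mulr_ge0 // subr_ge0 ler_ln.
  have se : s < eta by exact: (sAB' (y, m)).
  have -> : sphere_inv m y = expR s *: y.
    rewrite /sphere_inv /s mulrBr expRB !expRM_natl; congr (_ *: _).
    by rewrite !lnK ?posrE // sqr_enorm.
  have dr (t : R) := @is_derive_ray _ _ w wd y t (fun x h => (wder x h).1) y0.
  have [|c] := MVT_segment s0 (fun t _ => dr t).
    by apply: derivable_within_continuous => t _; exact: (@ex_derive _ _ _ _ _ _ _ (dr t)).
  rewrite in_itv/= => /andP[c0 cs'].
  rewrite expR0 scale1r subr0 => E.
  rewrite -subr_ge0 E mulr_ge0 //; apply/ltW.
  apply: (sAB (y, c)); split => //=; apply: sB.
  by rewrite /ball /= sub0r normrN ger0_norm // (le_lt_trans cs').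
Qed.

(** The set of radii up to which all comparisons hold contains [r0]; its supremum, if
    finite, is attained by continuity and then exceeded by [reflects_near]. *)
Lemma reflects_all {R : realType} {N : nat} (g del p : R)
    (w wd : 'rV[R]_N -> R) (lam : R) :
  0 < g -> 1 < p -> 0 < del -> cyl_solution g del p w wd ->
  0 < lam -> reflects w lam.
Proof.
move=> g0 p1 d0 S l0; apply: contrapT => bad.
have [wp weq wder wlim [r0 r00 small]] := S.
have base m : 0 < m -> m <= r0 -> reflects w m.
  move=> m0 mr; apply: (reflects_from_outer p1 d0 S r00 small) => // x x0 /andP[rx xm].
  by rewrite sphere_inv_fixed //; apply/eqP; rewrite eq_le xm (le_trans mr).
pose A := [set l : R | 0 < l /\ forall m, 0 < m -> m <= l -> reflects w m].
have Ar0 : A r0 by split => // m; exact: base.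
have Aub : ubound A lam.
  by move=> l [l0' hl]; rewrite leNgt; apply/negP => h; apply: bad; apply: hl => //; exact: ltW.
have supA : has_sup A by split; [exists r0|exists lam].
pose L := sup A.
have r0L : r0 <= L by apply: ub_le_sup => //; exists lam.
have L0 : 0 < L := lt_le_trans r00 r0L.
have below m : 0 < m -> m < L -> reflects w m.
  move=> m0 mL; have [l [_ hl] ml] := sup_adherent (eps := L - m) ltac:(by rewrite subr_gt0) supA.
  by apply: hl => //; rewrite ltW // -(subKr L m).
have goodL : reflects w L.
  move=> x x0; rewrite le_eqVlt => /orP[/eqP xL|xL]; first by rewrite sphere_inv_fixed.
  rewrite leNgt; apply/negP => h.
  have cv : (fun m => w (sphere_inv m x)) @ L --> w (sphere_inv L x).
    apply: (@cvg_comp _ _ _ (fun m => sphere_inv m x) w _ (nbhs (sphere_inv L x))).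
      by apply: sphere_inv_cvg => //; exact: cvg_cst.
    by apply: (wp _ _).2; exact: sphere_inv_neq0.
  have /nbhs_ballP[e /= e0 he] : \forall m \near L, w (sphere_inv m x) < w x.
    by apply: (cvgr_lt _ cv).
  have xp : 0 < enorm x by rewrite enorm_gt0.
  pose m := Num.max (enorm x) (L - e / 2).
  have mx : enorm x <= m by rewrite le_max lexx.
  have me : L - e / 2 <= m by rewrite le_max lexx orbT.
  have mL : m < L by rewrite gt_max xL; lra.
  have : w (sphere_inv m x) < w x.
    by apply: he; rewrite /ball /= gtr0_norm ?subr_gt0 //; lra.
  by apply/negP; rewrite -leNgt; apply: below => //; exact: lt_le_trans mx.
have : \forall m \near L, annulus r0 (L + 1) `<=`
    [set y : 'rV[R]_N | L < m -> enorm y <= m -> w y <= w (sphere_inv m y)].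
  have /compact_near_coveringP cov := @annulus_compact R N r0 (L + 1).
  apply: (cov R (nbhs L) (fun m y => L < m -> enorm y <= m -> w y <= w (sphere_inv m y))).
  move=> x /andP[rx _].
  have x0 : x != 0 by rewrite -enorm_gt0 (lt_le_trans r00).
  exact: (reflects_near g0 p1 d0 S L0 goodL x0).
move=> /nbhs_ballP[e /= e0 he].
pose e' := Num.min e 1 / 2.
have m1 : 0 < Num.min e 1 by rewrite lt_min e0 ltr01.
have m2 : Num.min e 1 <= e by rewrite ge_min lexx.
have m3 : Num.min e 1 <= 1 by rewrite ge_min lexx orbT.
have : A (L + e').
  split; first by rewrite /e'; lra.
  move=> m m0 mL; have [|Lm] := leP m L.
    by rewrite le_eqVlt => /orP[/eqP ->|]; [|exact: below].
  apply: (reflects_from_outer p1 d0 S r00 small) => // x x0 /andP[rx xm].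
  have hm : ball L e m by rewrite /ball /= ltr0_norm ?subr_lt0 //; rewrite /e' in mL; lra.
  apply: (he m hm x) => //.
  by rewrite /annulus /= rx /=; rewrite /e' in mL; lra.
have ubA : has_ubound A by exists lam.
move=> /(ub_le_sup ubA); rewrite -/L /e'; lra.
Qed.

(** Comparing across the sphere of radius |x| sqrt c shows that w grows along rays.
    Far from the origin the nonlinearity then exceeds (g^2 + 1) w, which is too much
    for a positive function on an interval of length pi in the log-radius. *)
Lemma no_cyl_solution {R : realType} {N : nat} (g del p : R)
    (w wd : 'rV[R]_N -> R) :
  (0 < N)%N -> 0 < g -> 1 < p -> 0 < del -> cyl_solution g del p w wd -> False.
Proof.
move=> N0 g0 p1 d0 S; have [wp weq _ _ _] := S.
have mono x c : x != 0 -> 1 <= c -> w x <= w (c *: x).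
  move=> x0 c1; have c0 : 0 < c := lt_le_trans ltr01 c1.
  have e0 : 0 < enorm x by rewrite enorm_gt0.
  pose lam := enorm x * Num.sqrt c.
  have s1 : 1 <= Num.sqrt c by rewrite -sqrtr1 ler_wsqrtr.
  have l0 : 0 < lam by rewrite mulr_gt0 // sqrtr_gt0.
  have := reflects_all g0 p1 d0 S l0 x0; rewrite /lam ler_peMr ?enorm_ge0 // => /(_ isT).
  rewrite /sphere_inv exprMn (sqr_sqrtr (ltW c0)) sqr_enorm mulrAC divff ?mul1r //.
  by rewrite gt_eqF // nsq_gt0.
pose e1 : 'rV[R]_N := evec R (Ordinal N0).
have ne1 : enorm e1 = 1.
  rewrite /enorm (bigD1 (Ordinal N0)) //= big1 => [|k /negbTE k0].
    by rewrite mxE !eqxx addr0 expr1n sqrtr1.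
  by rewrite mxE k0 andbF expr0n.
have cw x : x != 0 -> {for x, continuous w} by move=> /wp[].
have [x1 K1 min1] : exists2 x, annulus 1 1 x & forall y, annulus 1 1 y -> w x <= w y.
  by apply: annulus_min => //; exists e1; rewrite /annulus /= ne1 lexx.
have x10 : x1 != 0.
  by rewrite -enorm_gt0; move: K1 => /andP[h _]; exact: lt_le_trans h.
pose m := w x1; have m0 : 0 < m := (wp x1 x10).1.
have wm x : 1 <= enorm x -> m <= w x.
  move=> h; have e0 : 0 < enorm x := lt_le_trans ltr01 h.
  have x0 : x != 0 by rewrite -enorm_gt0.
  pose y := (enorm x)^-1 *: x.
  have ey : enorm y = 1 by rewrite enormZ gtr0_norm ?invr_gt0 // mulVf ?gt_eqF.
  have y0 : y != 0 by rewrite -enorm_gt0 ey.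
  have -> : x = enorm x *: y by rewrite scalerA divff ?scale1r // gt_eqF.
  by apply: le_trans (mono _ _ y0 h); apply: min1; rewrite /annulus /= ey lexx.
(* K is the value of |x|^d from which the nonlinearity exceeds (g^2 + 1) w;
   it is at least 1, hence so is the radius r where it is reached *)
pose K := 1 + (g ^+ 2 + 1) / m `^ (p - 1).
have mp0 : 0 < m `^ (p - 1) by rewrite powR_gt0.
have K1' : 1 <= K.
  by rewrite lerDl divr_ge0 ?powR_ge0 // addr_ge0 // exprn_ge0 // ltW.
have K0 : 0 < K := lt_le_trans ltr01 K1'.
pose r := K `^ del^-1.
have rd : r `^ del = K by rewrite -powRrM mulVf ?gt_eqF // powRr1 // ltW.
have r1 : 1 <= r.
  by rewrite -(powRr0 K); apply: ler_powR => //; rewrite invr_ge0 ltW.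
have r0 : 0 < r := lt_le_trans ltr01 r1.
have rr : 0 < ln r + 1 by rewrite ltr_wpDl // ln_ge0.
pose phi (y : 'rV[R]_N) := sin (ln (enorm y) - ln r).
have phicyl y : y != 0 -> is_cyl_lap phi y (- phi y).
  move=> y0; apply: (is_cyl_lap_radial (G := fun t => sin (t - ln r))
     (G' := fun t => cos (t - ln r)) y0).
    move=> t; apply: is_derive_fun_comp (is_derive_sin _) (is_derive_funB (is_derive_funId _ erefl) (is_derive_funC _ _ erefl) erefl) _.
    by rewrite subr0 mulr1.
  apply: is_derive_fun_comp (is_derive_cos _) (is_derive_funB (is_derive_funId _ erefl) (is_derive_funC _ _ erefl) erefl) _.
  by rewrite subr0 mulr1.
(* where q is smallest, the multiple of phi equal to w at that point touches w from below *)
pose q y := - (phi y / w y).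
have cq y : y != 0 -> {for y, continuous q}.
  move=> y0; apply: (cvgN (FF := nbhs_filter y)).
  apply: (cvgM (FF := nbhs_filter y)).
    apply: (@cvg_comp _ _ _ (fun y => ln (enorm y) - ln r) (@sin R) _
       (nbhs (ln (enorm y) - ln r))); last exact: continuous_sin.
    apply: (cvgB (FF := nbhs_filter y)); last exact: cvg_cst.
    apply: (@cvg_comp _ _ _ _ (@ln R) _ (nbhs (enorm y))); first exact: enorm_continuous.
    by apply: continuous_ln; rewrite enorm_gt0.
  apply: (cvgV (FF := nbhs_filter y)); last exact: cw.
  by rewrite gt_eqF // (wp y y0).1.
pose s := r * expR pi.
have expln t : r * expR t = expR (ln r + t) by rewrite expRD lnK ?posrE.
pose z := (r * expR (pi / 2)) *: e1.
have ez : enorm z = r * expR (pi / 2).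
  by rewrite enormZ ne1 mulr1 ger0_norm // mulr_ge0 ?expR_ge0 // ltW.
have pi0 : 0 < (pi : R) := pi_gt0 R.
have lez : ln (enorm z) - ln r = pi / 2 by rewrite ez expln expRK addrC addKr.
have Kz : annulus r s z.
  rewrite /annulus /= ez ler_pMr // ler_pM2l // ler_expR.
  by apply/andP; split; [rewrite ltW // expR_gt1; lra|lra].
have z0 : z != 0 by rewrite -enorm_gt0 ez mulr_gt0 // expR_gt0.
have [x2 K2 min2] := annulus_min r0 cq (ex_intro _ z Kz).
move: (K2) => /andP[x2a x2b].
have e2 : 0 < enorm x2 := lt_le_trans r0 x2a.
have x20 : x2 != 0 by rewrite -enorm_gt0.
have w2 := (wp x2 x20).1.
have q2 : q x2 < 0.
  apply: le_lt_trans (min2 z Kz) _.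
  by rewrite oppr_lt0 /phi lez sin_pihalf divr_gt0 // (wp z z0).1.
have phi2 : 0 < phi x2 by move: q2; rewrite /q oppr_lt0 pmulr_lgt0 // invr_gt0.
have lt2 : r < enorm x2 < s.
  rewrite !lt_neqAle x2a x2b !andbT; apply/andP; split; apply/eqP => h.
    by move: phi2; rewrite /phi -h subrr sin0 ltxx.
  by move: phi2; rewrite /phi h /s expln expRK addrC addKr sinpi ltxx.
pose c := w x2 / phi x2.
have locmin : \forall y \near x2, w x2 - c * phi x2 <= w y - c * phi y.
  apply: filterS (annulus_near lt2) => y /andP[h1 h2].
  have y0 : y != 0 by rewrite -enorm_gt0 (lt_trans r0).
  have Ky : annulus r s y by rewrite /annulus /= !ltW.
  have wy := (wp y y0).1.
  rewrite /c divfK ?gt_eqF // subrr subr_ge0.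
  have := min2 y Ky; rewrite /q lerN2 ler_pdivrMr //.
  rewrite mulrAC ler_pdivlMr // => h.
  by rewrite mulrAC ler_pdivrMr // (mulrC (w x2)) (mulrC (w y)).
have cphi : is_cyl_lap (fun y => c * phi y) x2 (c * - phi x2).
  have [dA [A [d [B [hA hB E]]]]] := phicyl x2 x20.
  exists (fun i j => c * dA i j), (fun i j => c * A i j), (c * d), (c * B); split.
  - by move=> i j ij; apply: is_deriv2Z; exact: hA.
  - exact: is_deriv2Z.
  - by rewrite E; under [in RHS]eq_bigr => i _ do rewrite -mulr_sumr; rewrite -mulr_sumr; ring.
have := is_cyl_lap_min (is_cyl_lapB (weq x2 x20) cphi) locmin.
apply/negP; rewrite -ltNge mulrN opprK /c divfK ?gt_eqF //.
have h1 : K <= enorm x2 `^ del by rewrite -rd; apply: le_powR => //; exact: ltW.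
have h2 : m `^ (p - 1) <= w x2 `^ (p - 1).
  by apply: le_powR => //; [lra|apply: wm; exact: le_trans x2a].
have h3 : g ^+ 2 + 1 < K * m `^ (p - 1).
  by rewrite mulrDl divfK ?gt_eqF // mul1r ltrDr.
have h4 : K * m `^ (p - 1) <= enorm x2 `^ del * w x2 `^ (p - 1).
  by apply: ler_pM => //; exact: ltW.
have -> : w x2 `^ p = w x2 * w x2 `^ (p - 1) by rewrite mulr_powRB1 ?ltW //; lra.
have h5 : (g ^+ 2 + 1) * w x2 < enorm x2 `^ del * w x2 `^ (p - 1) * w x2.
  by rewrite ltr_pM2r // (lt_le_trans h3).
by move: h5; rewrite mulrDl; set X := enorm x2 `^ del; set Y := w x2 `^ (p - 1);
  rewrite (mulrC (w x2) Y) mulrA; lra.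
Qed.

(** * Non-existence in the subcritical case *)
Lemma powR_continuous {R : realType} (s t : R) : 0 < t -> {for t, continuous (fun z => z `^ s)}.
Proof. by move=> t0; exact: is_derive_cont (is_derive1_powR s t0). Qed.

Lemma powR_small {R : realType} (s e : R) : 0 < s -> 0 < e ->
  exists2 r, 0 < r & forall t, 0 < t -> t <= r -> t `^ s <= e.
Proof.
move=> s0 e0; exists (e `^ s^-1); first by rewrite powR_gt0.
move=> t t0 tr; rewrite (_ : e = (e `^ s^-1) `^ s); last first.
  by rewrite -powRrM mulVf ?gt_eqF // powRr1 // ltW.
by apply: le_powR => //; exact: ltW.
Qed.

(** The topology is that of the sup norm, which is dominated by the Euclidean norm. *)
Lemma continuous_bounded0 {R : realType} {N : nat} (u : 'rV[R]_N -> R) :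
  {for 0, continuous u} ->
  exists2 r, 0 < r & forall x, enorm x <= r -> u x < u 0 + 1.
Proof.
move=> cu.
have /nbhs_ballP[r /= r0 hr] : nbhs (0 : 'rV[R]_N) (fun x => u x < u 0 + 1).
  by apply: (cvgr_lt (FF := nbhs_filter (0 : 'rV[R]_N)) _ cu); rewrite ltrDl.
exists (r / 2); first lra.
move=> x xr; apply: hr; split => // i j; rewrite ord1 mxE /ball /= sub0r normrN.
by apply: le_lt_trans (coord_le_enorm x j) _; lra.
Qed.

Lemma positive_solution_cyl {R : realType} {N : nat} (g a b p : R) (u : 'rV[R]_N -> R) :
  positive_solution a b p u -> a = 2 * g - N%:R + 2 -> 0 < g -> 1 < p -> 0 < b - a + 2 ->
  cyl_solution g (b - a + 2 - g * (p - 1)) p (fun y => enorm y `^ g * u y)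
    (fun y => enorm y `^ g * (g * u y + euler u y)).
Proof.
move=> S ag g0 p1 s0; have [up Cu cu _] := S.
have ce x : x != 0 -> {for x, continuous (fun y : 'rV[R]_N => enorm y `^ g)}.
  move=> x0; apply: (@cvg_comp _ _ _ (@enorm R N) (fun z => z `^ g) _ (nbhs (enorm x))).
    exact: enorm_continuous.
  by apply: powR_continuous; rewrite enorm_gt0.
have [r1 r10 hr1] := continuous_bounded0 (cu 0).
pose M := u 0 + 1; have M0 : 0 < M by rewrite addr_gt0.
split.
- move=> x x0; split; first by rewrite mulr_gt0 // powR_gt0 // enorm_gt0.
  by apply: (cvgM (FF := nbhs_filter x)); [exact: ce|exact: cu].
- by move=> x x0; exact: is_cyl_lap_solution.
- move=> x x0; split; first exact: is_deriv2_derive (is_deriv2_ray g Cu x0).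
  apply: (cvgM (FF := nbhs_filter x)); first exact: ce.
  apply: (cvgD (FF := nbhs_filter x)).
    by apply: (cvgMl_tmp (FF := nbhs_filter x)); exact: cu.
  apply: (cvg_sum_ord (FF := nbhs_filter x)) => k.
  apply: (cvgM (FF := nbhs_filter x)); first exact: coord_continuous.
  by have [_ /(_ k)[]] := Cu _ x0.
- move=> e e0; have [r2 r20 hr2] := powR_small g0 (divr_gt0 e0 M0).
  exists (Num.min r1 r2); first by rewrite lt_min r10.
  move=> x x0; rewrite le_min => /andP[xr1 xr2].
  have ex : 0 < enorm x by rewrite enorm_gt0.
  rewrite -[ltRHS](divfK (lt0r_neq0 M0)).
  apply: (@le_lt_trans _ _ (e / M * u x)).
    by apply: ler_wpM2r; [exact: ltW|exact: hr2].
  by rewrite ltr_pM2l ?divr_gt0 //; exact: hr1.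
- have Mp0 : 0 < p * M `^ (p - 1) by rewrite mulr_gt0 ?powR_gt0 //; lra.
  have g20 : 0 < g ^+ 2 / 2 by rewrite divr_gt0 // exprn_gt0.
  have [r2 r20 hr2] := powR_small s0 (divr_gt0 g20 Mp0).
  exists (Num.min r1 r2); first by rewrite lt_min r10.
  move=> x x0; rewrite le_min => /andP[xr1 xr2].
  have ex : 0 < enorm x by rewrite enorm_gt0.
  have -> : enorm x `^ (b - a + 2 - g * (p - 1)) * (enorm x `^ g * u x) `^ (p - 1) =
      enorm x `^ (b - a + 2) * u x `^ (p - 1).
    rewrite powRM ?powR_ge0 //; last exact: ltW.
    by rewrite mulrA -powRrM -powR_add // subrK.
  have h1 := hr2 _ ex xr2.
  have h2 : u x `^ (p - 1) <= M `^ (p - 1).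
    by apply: le_powR => //; [lra|exact: ltW (hr1 _ xr1)].
  apply: (@le_lt_trans _ _ (g ^+ 2 / 2)); last by have := exprn_gt0 2 g0; lra.
  rewrite -[leRHS](divfK (lt0r_neq0 Mp0)).
  rewrite mulrCA; apply: ler_pM => //; rewrite ?powR_ge0 //.
    by rewrite mulr_ge0 ?powR_ge0 //; lra.
  by apply: ler_wpM2l => //; lra.
Qed.

Theorem no_solution_subcritical (R : realType) (N : nat) (a b p : R) :
  (0 < N)%N -> 1 < p -> a - 2 < b -> - N%:R < a - 2 -> p < p_S N a b ->
  ~ exists u : 'rV[R]_N -> R, positive_solution a b p u.
Proof.
move=> hN hp hab ha hps [u S].
pose g := (N%:R - 2 + a) / 2.
have g0 : 0 < g by rewrite /g; lra.
have ag : a = 2 * g - N%:R + 2 by rewrite /g; field.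
have s0 : 0 < b - a + 2 by lra.
apply: (no_cyl_solution hN g0 hp _ (positive_solution_cyl S ag g0 hp s0)).
move: hps; rewrite /p_S ltr_pdivlMr; last by rewrite /g in g0; lra.
by rewrite /g; lra.
Qed.

(** * Primitives and a Lipschitz modification of the power *)
(** The integral starts at -1 so that the fundamental theorem of calculus applies in a
    neighbourhood of 0 as well. *)
Definition primitive {R : realType} (f : R -> R) (x : R) : R :=
  (\int[lebesgue_measure]_(t in `[-1, x]) f t)%R -
  (\int[lebesgue_measure]_(t in `[-1, 0]) f t)%R.

Lemma primitive0 {R : realType} (f : R -> R) : primitive f 0 = 0.
Proof. by rewrite /primitive subrr. Qed.

Lemma is_derive_primitive {R : realType} (f : R -> R) (x : R) :
  continuous f -> -1 < x -> is_derive x (1 : R) (primitive f) (f x).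
Proof.
move=> cf x1.
have fi : (@lebesgue_measure R).-integrable `[-1, x + 1] (EFin \o f).
  apply: continuous_compact_integrable; first exact: segment_compact.
  exact: continuous_subspaceT.
have [|d1 d2] := @continuous_FTC1_closed R f (-1) x (x + 1) _ fi x1 (cf x).
  by rewrite ltrDl.
apply: is_derive_funB (is_derive_funC _ _ erefl) _.
  by apply: DeriveDef; [exact: d1|rewrite -derive1E].
by rewrite subr0.
Qed.

Lemma primitive_mean {R : realType} (f : R -> R) (s : R) : continuous f -> 0 < s ->
  exists2 c, 0 < c < s & primitive f s = f c * s.
Proof.
move=> cf s0.
have d (t : R) : 0 <= t -> is_derive t (1 : R) (primitive f) (f t).
  by move=> t0; apply: is_derive_primitive => //; lra.
have [||c] := @MVT _ (primitive f) f 0 s s0.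
- by move=> t; rewrite in_itv /= => /andP[/ltW t0 _]; exact: d.
- apply: derivable_within_continuous => t; rewrite in_itv/= => /andP[t0 _].
  exact: (@ex_derive _ _ _ _ _ _ _ (d t t0)).
by rewrite in_itv /= primitive0 !subr0 => cs E; exists c.
Qed.

Lemma derive_ge0_le {R : realType} (f df : R -> R) (a b : R) :
  a <= b -> (forall x : R, a < x < b -> is_derive x (1 : R) f (df x) /\ 0 <= df x) ->
  {within `[a, b], continuous f} -> f a <= f b.
Proof.
rewrite le_eqVlt => /orP[/eqP -> //|ab] d c.
have [x|//|x] := @MVT _ f df a b ab; first by rewrite in_itv /= => /d[].
rewrite in_itv /= => /d[_ h] E.
by rewrite -subr_ge0 E mulr_ge0 // subr_ge0 ltW.
Qed.

(** For s > 0, continuous on the whole line, unlike [powR] whose value is 1 at negative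
    numbers. *)
Definition trunc_powR {R : realType} (s x : R) : R := (Num.max 0 x) `^ s.

Lemma trunc_powRE {R : realType} (s x : R) : 0 <= x -> trunc_powR s x = x `^ s.
Proof. by move=> x0; rewrite /trunc_powR max_r. Qed.

Lemma trunc_powR_ge0 {R : realType} (s x : R) : 0 <= trunc_powR s x.
Proof. exact: powR_ge0. Qed.

Lemma trunc_powR_le {R : realType} (s x y : R) : 0 < s -> x <= y -> trunc_powR s x <= trunc_powR s y.
Proof.
move=> s0 xy; apply: (ge0_ler_powR (ltW s0)).
- by rewrite nnegrE le_max lexx.
- by rewrite nnegrE le_max lexx.
- by rewrite ge_max !le_max lexx xy orbT.
Qed.

Lemma trunc_powR_continuous {R : realType} (s : R) : 0 < s -> continuous (trunc_powR s).
Proof.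
move=> s0 x; rewrite /continuous_at; have [x0|x0|<-] := ltgtP 0 x.
- rewrite trunc_powRE ?(ltW x0) //.
  have : (fun z => z `^ s) @ x --> x `^ s by exact: powR_continuous.
  apply: cvg_trans; apply: near_eq_cvg.
  by near=> t; rewrite trunc_powRE //; apply/ltW; near: t; exact: lt_nbhsr.
- have -> : trunc_powR s x = 0 by rewrite /trunc_powR max_l ?ltW // powR0 // gt_eqF.
  have : (fun _ : R => 0 : R) @ x --> (0 : R) by exact: cvg_cst.
  apply: cvg_trans; apply: near_eq_cvg; near=> t; rewrite /trunc_powR max_l ?powR0 ?gt_eqF //=.
  by apply/ltW; near: t; exact: lt_nbhsl.
- have -> : trunc_powR s 0 = 0 :> R by rewrite /trunc_powR maxxx powR0 // gt_eqF.
  apply/cvgrPdist_le => e e0; have [r r0 hr] := powR_small s0 e0.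
  apply/nbhs_ballP; exists r => //= t; rewrite /ball /= sub0r normrN => tr.
  rewrite sub0r normrN ger0_norm ?trunc_powR_ge0 //.
  have [t0|t0] := leP t 0; first by rewrite /trunc_powR max_l // powR0 ?gt_eqF // ltW.
  by rewrite trunc_powRE ?(ltW t0) //; apply: hr => //; apply: ltW; rewrite gtr0_norm in tr.
Unshelve. all: by end_near. Qed.

(** The power of y clamped to [0, 1]: globally Lipschitz, and equal to y^p on the range
    of the solution. *)
Definition clamped_powR {R : realType} (p y : R) : R := trunc_powR p (Num.min y 1).

Lemma clamped_powR_ge0 {R : realType} (p y : R) : 0 <= clamped_powR p y.
Proof. exact: trunc_powR_ge0. Qed.

Lemma clamped_powRE {R : realType} (p y : R) : 0 <= y <= 1 -> clamped_powR p y = y `^ p.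
Proof. by move=> /andP[y0 y1]; rewrite /clamped_powR min_l // trunc_powRE. Qed.

Lemma clamped_powR_le1 {R : realType} (p y : R) : 0 < p -> clamped_powR p y <= 1.
Proof.
move=> p0; apply: (@le_trans _ _ (trunc_powR p 1)).
  by apply: trunc_powR_le => //; rewrite ge_min lexx orbT.
by rewrite trunc_powRE // powR1.
Qed.

Lemma clamped_powR_lip {R : realType} (p y z : R) : 1 <= p ->
  `|clamped_powR p y - clamped_powR p z| <= p * `|y - z|.
Proof.
move=> p1; have p0 : 0 < p := lt_le_trans ltr01 p1.
wlog yz : y z / y <= z.
  move=> H; have [/H //|/ltW/H] := leP y z.
  by rewrite distrC [`|z - y|]distrC.
pose y' := Num.max 0 (Num.min y 1); pose z' := Num.max 0 (Num.min z 1).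
have y'0 : 0 <= y' by rewrite le_max lexx.
have yz' : y' <= z'.
  rewrite ge_max !le_max lexx /=; apply/orP; right.
  by rewrite le_min ge_min yz /= ge_min lexx orbT.
have z'1 : z' <= 1 by rewrite ge_max ler01 /= ge_min lexx orbT.
have d : z' - y' <= z - y.
  have hmax (s t : R) : s <= t -> Num.max 0 t - Num.max 0 s <= t - s.
    by case: (leP 0 s) => ?; case: (leP 0 t) => ? ?; lra.
  have hmin : Num.min z 1 - Num.min y 1 <= z - y.
    by case: (leP y 1) => ?; case: (leP z 1) => ?; lra.
  apply: le_trans (hmax _ _ _) hmin.
  by rewrite le_min !ge_min lexx yz orbT.
have h : clamped_powR p y <= clamped_powR p z.
  by apply: trunc_powR_le => //; rewrite le_min !ge_min lexx yz orbT.
rewrite ler0_norm ?subr_le0 // ler0_norm ?subr_le0 // !opprB.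
have [z0|z0] := leP z' 0.
  have e1 : z' = 0 by apply/eqP; rewrite eq_le z0 (le_trans y'0).
  have e2 : y' = 0 by apply/eqP; rewrite eq_le y'0 -e1 yz'.
  rewrite /clamped_powR /trunc_powR -/y' -/z' e1 e2 subrr mulr_ge0 ?subr_ge0 //; lra.
apply: (le_trans (powR_tangent p1 y'0 yz' z0)).
apply: ler_pM => //; rewrite ?subr_ge0 //; first by rewrite mulr_ge0 ?powR_ge0 // ltW.
rewrite ler_piMr ?(ltW p0) //.
apply: (@le_trans _ _ (1 `^ (p - 1))); last by rewrite powR1.
by apply: le_powR => //; lra.
Qed.

Lemma clamped_powR_continuous {R : realType} (p : R) : 1 <= p -> continuous (clamped_powR p).
Proof.
move=> p1 x; have p0 : 0 < p := lt_le_trans ltr01 p1.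
apply/cvgrPdist_lt => e e0; apply/nbhs_ballP; exists (e / p) => /=.
  by rewrite divr_gt0.
move=> t; rewrite /ball /= => xt; apply: le_lt_trans (clamped_powR_lip _ _ p1) _.
by rewrite mulrC -ltr_pdivlMr.
Qed.

(** * The radial equation: Picard iteration *)
Definition source {R : realType} (k p : R) (u : R -> R) (x : R) : R :=
  trunc_powR (k - 1) x * clamped_powR p (u x).

(** The equation (s^k U')' = - s^(k-1) f(U) with U 0 = 1, integrated twice; exchanging
    the two integrations leaves the kernel (1 - (x / s)^(k-1)) / (k - 1), which is
    bounded although the equation is singular at 0. *)
Definition picard {R : realType} (k p : R) (u : R -> R) (s : R) : R :=
  if s <= 0 then 1 else
  1 - (k - 1)^-1 * (primitive (fun x => clamped_powR p (u x)) s
                    - s `^ (1 - k) * primitive (source k p u) s).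

Lemma clamped_powR_comp_continuous {R : realType} (p : R) (u : R -> R) :
  1 <= p -> continuous u -> continuous (fun x => clamped_powR p (u x)).
Proof.
move=> p1 cu x; apply: (@cvg_comp _ _ _ u (clamped_powR p) _ (nbhs (u x))); first exact: cu.
exact: clamped_powR_continuous.
Qed.

Lemma source_continuous {R : realType} (k p : R) (u : R -> R) :
  1 < k -> 1 <= p -> continuous u -> continuous (source k p u).
Proof.
move=> k1 p1 cu x; apply: cvgM; last exact: clamped_powR_comp_continuous.
by apply: trunc_powR_continuous; lra.
Qed.

Lemma source_ge0 {R : realType} (k p : R) (u : R -> R) (x : R) : 0 <= source k p u x.
Proof. by rewrite mulr_ge0 // ?trunc_powR_ge0 // clamped_powR_ge0. Qed.

Lemma primitive_source_bounds {R : realType} (k p : R) (u : R -> R) (s : R) :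
  1 < k -> 1 <= p -> continuous u -> 0 < s ->
  0 <= primitive (source k p u) s <= s `^ k.
Proof.
move=> k1 p1 cu s0.
have [c /andP[c0 cs] ->] := primitive_mean (source_continuous k1 p1 cu) s0.
rewrite mulr_ge0 ?source_ge0 ?(ltW s0) //=.
have -> : s `^ k = s `^ (k - 1) * s by rewrite mulrC mulr_powRB1 ?(ltW s0) //; lra.
apply: ler_wpM2r; first exact: ltW.
apply: (@le_trans _ _ (s `^ (k - 1) * 1)); last by rewrite mulr1.
apply: ler_pM; rewrite ?trunc_powR_ge0 ?clamped_powR_ge0 //; last by apply: clamped_powR_le1; lra.
by rewrite trunc_powRE ?(ltW c0) //; apply: le_powR => //; [lra|exact: ltW].
Qed.

Lemma is_derive_picard {R : realType} (k p : R) (u : R -> R) (s : R) :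
  1 < k -> 1 <= p -> continuous u -> 0 < s ->
  is_derive s (1 : R) (picard k p u) (- (s `^ (- k) * primitive (source k p u) s)).
Proof.
move=> k1 p1 cu s0.
pose F t := 1 - (k - 1)^-1 * (primitive (fun x => clamped_powR p (u x)) t
                    - t `^ (1 - k) * primitive (source k p u) t).
apply: (@near_eq_is_derive _ _ _ F).
  near=> t; rewrite /picard leNgt; have -> //: 0 < t.
  by near: t; exact: lt_nbhsr.
have s1 : -1 < s by lra.
have d0 := is_derive_primitive (clamped_powR_comp_continuous p1 cu) s1.
have d1 := is_derive_primitive (source_continuous k1 p1 cu) s1.
have dp : is_derive s (1 : R) (fun t => t `^ (1 - k)) ((1 - k) * s `^ (1 - k - 1)).
  exact: is_derive1_powR.
have := is_derive_funB (is_derive_funC 1 s erefl) (is_derive_funZ (is_derive_funB d0 (is_derive_funM dp d1 erefl) erefl) (erefl ((k - 1)^-1 * _))) erefl.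
move=> h; apply: (is_derive_eq h).
have -> : 1 - k - 1 = - k by ring.
rewrite /source trunc_powRE ?(ltW s0) //.
set G := primitive _ s; set f := clamped_powR p (u s).
have e1 : s `^ (1 - k) * s `^ (k - 1) = 1.
  by rewrite -powR_add // (_ : 1 - k + (k - 1) = 0) ?powRr0 //; ring.
have -> : s `^ (1 - k) * (s `^ (k - 1) * f) = f by rewrite mulrA e1 mul1r.
by field; lra.
Unshelve. all: by end_near. Qed.

(** Continuity of the Picard operator at the singular point 0, and the size of the
    first increment of the iteration. *)
Lemma picard_near1 {R : realType} (k p : R) (u : R -> R) (s : R) :
  1 < k -> 1 <= p -> continuous u -> 0 < s ->
  `|picard k p u s - 1| <= 2 / (k - 1) * s.
Proof.
move=> k1 p1 cu s0; have sn : (s <= 0) = false by rewrite leNgt s0.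
rewrite /picard sn addrAC subrr sub0r normrN.
have [c _ E] := primitive_mean (clamped_powR_comp_continuous p1 cu) s0.
have b0 : 0 <= primitive (fun x => clamped_powR p (u x)) s <= s.
  rewrite E mulr_ge0 ?clamped_powR_ge0 ?(ltW s0) //= ler_piMl ?(ltW s0) //.
  by apply: clamped_powR_le1; lra.
have /andP[h0 h1] := primitive_source_bounds k1 p1 cu s0.
have b1 : 0 <= s `^ (1 - k) * primitive (source k p u) s <= s.
  rewrite mulr_ge0 ?powR_ge0 //=.
  have e1 : s `^ (1 - k) * s `^ k = s by rewrite -powR_add // subrK powRr1 // ltW.
  by rewrite -[leRHS]e1 ler_wpM2l // powR_ge0.
have kp : 0 < (k - 1)^-1 by rewrite invr_gt0; lra.
rewrite normrM gtr0_norm // mulrAC mulrC ler_wpM2r ?(ltW kp) //.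
by rewrite ler_norml; move: b0 b1; set A := primitive _ _; set B := _ * _;
  move=> /andP[? ?] /andP[? ?]; apply/andP; split; lra.
Qed.

Lemma picard_continuous {R : realType} (k p : R) (u : R -> R) :
  1 < k -> 1 <= p -> continuous u -> continuous (picard k p u).
Proof.
move=> k1 p1 cu s; have [s0|s0|<-] := ltgtP 0 s.
- exact: is_derive_cont (is_derive_picard k1 p1 cu s0).
- have p_s : picard k p u s = 1 by rewrite /picard ltW.
  rewrite /continuous_at p_s.
  have : (fun _ : R => 1 : R) @ s --> (1 : R) by exact: cvg_cst.
  apply: cvg_trans; apply: near_eq_cvg; near=> t.
  by rewrite /picard ltW //; near: t; exact: lt_nbhsl.
- have p_s : picard k p u 0 = 1 by rewrite /picard lexx.
  rewrite /continuous_at p_s.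
  apply/cvgrPdist_lt => e e0.
  have C0 : 0 < 2 / (k - 1) by rewrite divr_gt0 //; lra.
  apply/nbhs_ballP; exists (e / (2 / (k - 1))) => /=; first by rewrite divr_gt0.
  move=> t; rewrite /ball /= sub0r normrN => te; rewrite distrC.
  have [t0|t0] := leP t 0; first by rewrite /picard t0 subrr normr0.
  apply: le_lt_trans (picard_near1 k1 p1 cu t0) _.
  by rewrite mulrC -ltr_pdivlMr // -(gtr0_norm t0).
Unshelve. all: by end_near. Qed.

(** The weight e^(2 p x) turns the Lipschitz constant p into a contraction of factor
    1/2: the difference has derivative at most p M e^(2 p x), whose primitive is
    (M / 2) e^(2 p x). *)
Lemma picard_contraction {R : realType} (k p M : R) (u v : R -> R) :
  1 < k -> 1 <= p -> 0 <= M -> continuous u -> continuous v ->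
  (forall x, 0 <= x -> `|u x - v x| <= M * expR (2 * p * x)) ->
  forall x, 0 <= x -> `|picard k p u x - picard k p v x| <= M / 2 * expR (2 * p * x).
Proof.
move=> k1 p1 M0 cu cv uv x; have p0 : 0 < p := lt_le_trans ltr01 p1.
rewrite le_eqVlt => /orP[/eqP <-|x0].
  by rewrite /picard lexx subrr normr0 mulr_ge0 ?expR_ge0 // divr_ge0.
pose D t := picard k p u t - picard k p v t.
pose V t := t `^ (- k) * primitive (source k p u) t
            - t `^ (- k) * primitive (source k p v) t.
have dD (t : R) : 0 < t -> is_derive t (1 : R) D (- V t).
  move=> t0; apply: is_derive_funB (is_derive_picard k1 p1 cu t0) (is_derive_picard k1 p1 cv t0) _.
  by rewrite /V opprD.
have Vb (t : R) : 0 < t -> `|V t| <= p * M * expR (2 * p * t).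
  move=> t0.
  pose s y := source k p u y - source k p v y.
  have cs : continuous s by move=> y; apply: cvgB; exact: source_continuous.
  have t1 : -1 < t by lra.
  have ds (y : R) : 0 <= y -> is_derive y (1 : R)
      (fun y => primitive (source k p u) y - primitive (source k p v) y) (s y).
    move=> y0; apply: is_derive_funB erefl; apply: is_derive_primitive; try lra; exact: source_continuous.
  have [||c] := @MVT _ (fun y => primitive (source k p u) y - primitive (source k p v) y) s 0 t t0.
  - by move=> y; rewrite in_itv /= => /andP[/ltW y0 _]; exact: ds.
  - apply: derivable_within_continuous => y; rewrite in_itv/= => /andP[y0 _].
    exact: (@ex_derive _ _ _ _ _ _ _ (ds y y0)).
  rewrite in_itv => cE E; have {cE} /andP[c0 ct] : 0 < c < t := cE.
  rewrite (primitive0 (source k p u)) in E.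
  rewrite (primitive0 (source k p v)) in E.
  rewrite (subr0 0) in E.
  rewrite (subr0 t) in E.
  rewrite (subr0 (_ - _)) in E.
  rewrite /V -mulrBr E /s /source -mulrBr trunc_powRE ?(ltW c0) //.
  rewrite !normrM !(ger0_norm (powR_ge0 _ _)) (gtr0_norm t0).
  set d := `|clamped_powR p (u c) - _|.
  have hd : d <= p * M * expR (2 * p * t).
    apply: le_trans (clamped_powR_lip _ _ p1) _; rewrite -mulrA ler_wpM2l ?(ltW p0) //.
    apply: le_trans (uv c (ltW c0)) _; rewrite ler_wpM2l // ler_expR ler_wpM2l ?(ltW ct) //.
    by rewrite mulr_ge0 // ltW.
  have e1 : t `^ (- k) * (t `^ (k - 1) * t) = 1.
    rewrite -[X in _ * (_ * X)](powRr1 (ltW t0)) -!powR_add //.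
    by rewrite (_ : - k + (k - 1 + 1) = 0) ?powRr0 //; ring.
  have hc : c `^ (k - 1) <= t `^ (k - 1) by apply: le_powR (ltW ct) => //; rewrite subr_ge0 ltW.
  have -> : t `^ (- k) * (c `^ (k - 1) * d * t) = (t `^ (- k) * (c `^ (k - 1) * t)) * d by ring.
  apply: (@le_trans _ _ (t `^ (- k) * (t `^ (k - 1) * t) * d)); last by rewrite e1 mul1r.
  rewrite ler_wpM2r ?normr_ge0 // ler_wpM2l ?powR_ge0 //.
  by rewrite ler_wpM2r // ltW.
(* B dominates both D and - D since its derivative dominates that of both *)
pose B t := M / 2 * expR (2 * p * t).
have dB (t : R) : is_derive t (1 : R) B (p * M * expR (2 * p * t)).
  apply: is_derive_funZ (is_derive_fun_comp (is_derive_expR _) (is_derive_funZ (is_derive_funId _ erefl) erefl) erefl) _.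
  by rewrite mulr1; field.
have cD : continuous D by move=> y; apply: cvgB; exact: picard_continuous.
have cB : continuous B by move=> y; exact: is_derive_cont (dB y).
have D0 : D 0 = 0 by rewrite /D /picard lexx subrr.
have B0 : B 0 = M / 2 by rewrite /B mulr0 expR0 mulr1.
have M20 : 0 <= M / 2 by rewrite divr_ge0.
rewrite ler_norml -/(D x) -/(B x); apply/andP; split.
  have : B 0 + D 0 <= B x + D x.
    apply: (@derive_ge0_le _ (fun t => B t + D t) (fun t => p * M * expR (2 * p * t) - V t)).
    - exact: ltW.
    - move=> t /andP[t0 _]; split; first exact: is_derive_funD (dB t) (dD t t0) erefl.
      by have := Vb t t0; rewrite ler_norml => /andP[_ ?]; rewrite subr_ge0.
    - by apply: continuous_subspaceT => y; apply: cvgD; [exact: cB|exact: cD].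
  by rewrite D0 B0; lra.
have : B 0 - D 0 <= B x - D x.
  apply: (@derive_ge0_le _ (fun t => B t - D t) (fun t => p * M * expR (2 * p * t) + V t)).
  - exact: ltW.
  - move=> t /andP[t0 _]; split; first by apply: is_derive_funB (dB t) (dD t t0) _; rewrite opprK.
    by have := Vb t t0; rewrite ler_norml => /andP[? _]; lra.
  - by apply: continuous_subspaceT => y; apply: cvgB; [exact: cB|exact: cD].
by rewrite D0 B0; lra.
Qed.

Lemma half_pow_small {R : realType} (K e : R) : 0 < e -> exists n, K * 2^-1 ^+ n < e.
Proof.
move=> e0; exists (Num.bound (K / e)).
rewrite exprVn ltr_pdivrMr ?exprn_gt0 // mulrC -ltr_pdivrMr //.
exact: upper_nthrootP.
Qed.

(** The intervals of radius 2 K / 2^n around x n are nested. *)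
Lemma geometric_limit {R : realType} (x : nat -> R) (K : R) :
  (forall n, `|x n.+1 - x n| <= K * 2^-1 ^+ n) ->
  exists l, forall n, `|l - x n| <= 2 * K * 2^-1 ^+ n.
Proof.
move=> h.
(* end points of the nested intervals *)
pose a n := x n - 2 * K * 2^-1 ^+ n; pose b n := x n + 2 * K * 2^-1 ^+ n.
have K0 : 0 <= K by have := h 0%N; rewrite expr0 mulr1; apply: le_trans.
have aS n : a n <= a n.+1.
  by have := h n; rewrite ler_norml /a exprS => /andP[? ?]; lra.
have bS n : b n.+1 <= b n.
  by have := h n; rewrite ler_norml /b exprS => /andP[? ?]; lra.
have am : {homo a : m n / (m <= n)%N >-> m <= n} by apply/nondecreasing_seqP.
have bm : {homo b : m n / (m <= n)%N >-> n <= m} by apply/nonincreasing_seqP.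
have ab m n : a m <= b n.
  apply: le_trans (am _ _ (leq_maxl m n)) _; apply: le_trans (bm _ _ (leq_maxr m n)).
  rewrite /a /b; have : 0 <= K * 2^-1 ^+ maxn m n by rewrite mulr_ge0 // exprn_ge0 // invr_ge0.
  by lra.
exists (sup (range a)) => n.
have l1 : a n <= sup (range a).
  by apply: ub_le_sup; [exists (b 0%N) => _ [m _ <-]|exists n].
have l2 : sup (range a) <= b n.
  by apply: ge_sup; [exists (a 0%N), 0%N|move=> _ [m _ <-]].
by rewrite ler_norml; move: l1 l2; rewrite /a /b => ? ?; apply/andP; split; lra.
Qed.

Lemma picard_fixpoint {R : realType} (k p : R) : 1 < k -> 1 <= p ->
  exists u : R -> R, continuous u /\ forall s, 0 <= s -> u s = picard k p u s.
Proof.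
move=> k1 p1; have p0 : 0 < p := lt_le_trans ltr01 p1.
pose us n := iter n (picard k p) (fun=> 1 : R).
have cus n : continuous (us n).
  elim: n => [|n ih]; first by move=> y; exact: cvg_cst.
  exact: picard_continuous.
have neg n s : s <= 0 -> us n s = 1.
  by case: n => // n s0; rewrite /us iterS /picard s0.
pose C := 2 / (k - 1); have C0 : 0 < C by rewrite divr_gt0 //; lra.
have step n : forall s, 0 <= s -> `|us n.+1 s - us n s| <= C * 2^-1 ^+ n * expR (2 * p * s).
  elim: n => [|n ih] s s0.
    rewrite expr0 mulr1; move: s0; rewrite le_eqVlt => /orP[/eqP <-|s0].
      by rewrite !neg // subrr normr0 mulr_ge0 ?expR_ge0 // ltW.
    apply: le_trans (picard_near1 k1 p1 (cus 0%N) s0) _.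
    rewrite ler_wpM2l ?(ltW C0) //.
    by apply: le_trans (expR_ge1Dx _); nra.
  have := picard_contraction k1 p1 _ (cus n.+1) (cus n) ih s0.
  rewrite exprSr mulrA; apply.
  by rewrite mulr_ge0 ?(ltW C0) // exprn_ge0 // invr_ge0.
have step' n s : `|us n.+1 s - us n s| <= C * expR (2 * p * `|s|) * 2^-1 ^+ n.
  have [s0|/ltW s0] := leP 0 s.
    by rewrite (ger0_norm s0) mulrAC; exact: step.
  rewrite !neg // subrr normr0; apply: mulr_ge0; last by rewrite exprn_ge0 // invr_ge0.
  by rewrite mulr_ge0 ?expR_ge0 ?(ltW C0).
have /choice[u hu] : forall s, exists l, forall n,
    `|l - us n s| <= 2 * (C * expR (2 * p * `|s|)) * 2^-1 ^+ n.
  by move=> s; apply: geometric_limit => n; exact: step'.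
have cu : continuous u.
  move=> s; apply/cvgrPdist_lt => e e0.
  (* bounds the constants of convergence on the ball of radius 1 around s *)
  pose K := 2 * (C * expR (2 * p * (`|s| + 1))).
  have e30 : 0 < e / 3 by rewrite divr_gt0.
  have [n hn] := half_pow_small K e30.
  have close t : `|t| <= `|s| + 1 -> `|u t - us n t| < e / 3.
    move=> ts; apply: le_lt_trans (hu t n) _; apply: le_lt_trans hn.
    rewrite ler_wpM2r ?exprn_ge0 ?invr_ge0 // /K ler_wpM2l // ler_wpM2l ?(ltW C0) //.
    by rewrite ler_expR ler_wpM2l // mulr_ge0 // ltW.
  have : \forall t \near s, `|us n s - us n t| < e / 3.
    by have := cus n s; move=> /cvgrPdist_lt; apply.
  move=> /nbhs_ballP[r /= r0 hr]; apply/nbhs_ballP; exists (Num.min r 1) => /=.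
    by rewrite lt_min r0 ltr01.
  move=> t; rewrite /ball /= lt_min => /andP[tr t1].
  have h1 : `|u s - us n s| < e / 3 by apply: close; rewrite lerDl.
  have h2 := hr t tr.
  have h3 : `|u t - us n t| < e / 3.
    apply: close; rewrite -[t](subrK s) addrC; apply: le_trans (ler_normD _ _) _.
    by rewrite lerD2l distrC ltW.
  have -> : u s - u t = (u s - us n s) + (us n s - us n t) + - (u t - us n t) by ring.
  apply: le_lt_trans (ler_normD _ _) _; rewrite normrN.
  have := ler_normD (u s - us n s) (us n s - us n t).
  lra.
exists u; split => // s s0.
apply/eqP; rewrite -subr_eq0 -normr_eq0 eq_le normr_ge0 andbT.
rewrite leNgt; apply/negP => pos.
pose E := expR (2 * p * s).
have [n hn] := half_pow_small (2 * C * E) pos.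
have P0 : 0 <= 2 * C * 2^-1 ^+ n by rewrite mulr_ge0 ?exprn_ge0 ?invr_ge0 // mulr_ge0 // ltW.
have h1 := picard_contraction k1 p1 P0 cu (cus n) _ s0.
have {}h1 : `|picard k p u s - us n.+1 s| <= 2 * C * 2^-1 ^+ n / 2 * E.
  apply: h1 => x x0; have := hu x n; rewrite (ger0_norm x0).
  by rewrite mulrA mulrAC.
have h2 := hu s n.+1; rewrite (ger0_norm s0) -/E exprS in h2.
have tri : `|u s - picard k p u s| <= `|u s - us n.+1 s| + `|picard k p u s - us n.+1 s|.
  rewrite -[X in _ <= _ + X]normrN; apply: le_trans (ler_normD _ _).
  by rewrite opprB addrA subrK.
apply/negP: hn; rewrite -leNgt; apply: (le_trans tri); apply: (le_trans (lerD h2 h1)).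
by rewrite le_eqVlt; apply/orP; left; apply/eqP; field.
Qed.

(** * The radial equation: positivity *)
(** With s^k u' = - G, this is the Pohozaev function; the terms without u^(p+1) cancel
    in its derivative. *)
Lemma pohozaev_derive {R : realType} (k p : R) (u G : R -> R) (s : R) :
  1 < k -> 1 < p -> 0 < s -> 0 < u s ->
  is_derive s (1 : R) u (- (s `^ (- k) * G s)) ->
  is_derive s (1 : R) G (s `^ (k - 1) * u s `^ p) ->
  is_derive s (1 : R)
    (fun s => s `^ (1 - k) * (G s * G s) + 2 / (p + 1) * (s `^ k * u s `^ (p + 1))
              - (k - 1) * (u s * G s))
    ((2 * k / (p + 1) - (k - 1)) * (s `^ (k - 1) * u s `^ (p + 1))).
Proof.
move=> k1 p1 s0 us0 du dG.
have dpw (c : R) : is_derive s (1 : R) (fun s => s `^ c) (c * s `^ (c - 1)).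
  exact: is_derive1_powR.
have dup : is_derive s (1 : R) (fun s => u s `^ (p + 1))
    ((p + 1) * u s `^ (p + 1 - 1) * - (s `^ (- k) * G s)).
  by apply: (@is_derive_fun_comp _ (fun z => z `^ (p + 1)) u s _ _ _ _ du erefl); exact: is_derive1_powR.
have := is_derive_funB (is_derive_funD (is_derive_funM (dpw (1 - k)) (is_derive_funM dG dG erefl) erefl)
          (is_derive_funZ (is_derive_funM (dpw k) dup erefl) (erefl (2 / (p + 1) * _))) erefl)
          (is_derive_funZ (is_derive_funM du dG erefl) (erefl ((k - 1) * _))) erefl.
move=> h; apply: (is_derive_eq h).
have -> : 1 - k - 1 = - k by ring.
have -> : p + 1 - 1 = p by ring.
have e1 : s `^ (1 - k) * s `^ (k - 1) = 1.
  by rewrite -powR_add // (_ : 1 - k + (k - 1) = 0) ?powRr0 //; ring.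
have e2 : s `^ k * s `^ (- k) = 1 by rewrite -powR_add // subrr powRr0.
have e3 : u s `^ (p + 1) = u s `^ p * u s by rewrite powR_add // powRr1 // ltW.
rewrite e3; set X := s `^ (1 - k) in e1 *; set Y := s `^ (k - 1) in e1 *.
set Z := s `^ (- k) in e2 *; set W := s `^ k in e2 *; set F := u s `^ p; set g := G s.
have p10 : p + 1 != 0 by rewrite gt_eqF //; lra.
transitivity ((1 - k) * Z * (g * g) + (X * Y) * (2 * F * g)
   + 2 / (p + 1) * (k * Y * (F * u s) - (p + 1) * (W * Z) * (F * g))
   - (k - 1) * (- Z * g * g + Y * (F * u s))); first by ring.
by rewrite e1 e2; field.
Qed.

(** Let s0 be the infimum of the points where u <= 0. On (0, s0) the Pohozaev function
    tends to 0 at 0 and is nonincreasing, hence it is <= 0; without its middle term,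
    which is positive there, it extends continuously to s0, where it is positive. *)
Lemma emden_positive {R : realType} (k p : R) (u G : R -> R) :
  1 < k -> 1 < p -> (k + 1) / (k - 1) <= p -> u 0 = 1 -> continuous u ->
  (forall s : R, 0 < s -> is_derive s (1 : R) u (- (s `^ (- k) * G s))) ->
  (forall s : R, 0 < s -> is_derive s (1 : R) G (s `^ (k - 1) * clamped_powR p (u s))) ->
  (forall s, 0 < s -> 0 <= G s <= s `^ k) ->
  (forall s, 0 < s -> (forall t, 0 < t < s -> 0 < u t) -> 0 < G s) ->
  forall s, 0 <= s -> 0 < u s <= 1.
Proof.
move=> k1 p1 crit u0 cu du dG Gb Gpos.
have ule s : 0 <= s -> u s <= 1.
  rewrite le_eqVlt => /orP[/eqP <-|s0]; first by rewrite u0.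
  rewrite -u0 -lerN2.
  apply: (@derive_ge0_le _ (fun s => - u s) (fun s => s `^ (- k) * G s) 0 s (ltW s0)).
    move=> t /andP[t0 _]; split; first by apply: is_derive_funN (du t t0) _; rewrite opprK.
    by rewrite mulr_ge0 ?powR_ge0 //; case/andP: (Gb t t0).
  by apply: continuous_subspaceT => y; apply: cvgN; exact: cu.
move=> s sge; rewrite ule // andbT ltNge; apply/negP => us.
pose Z := [set t : R | 0 <= t /\ u t <= 0].
have Zs : Z s by [].
have hZ : has_inf Z by split; [exists s|exists 0 => t []].
pose s0 := inf Z.
have lbZ t : Z t -> s0 <= t by apply: ge_inf; exists 0 => r [].
have s0ge : 0 <= s0 by apply: lb_le_inf; [exists s|move=> t []].
have us0 : u s0 <= 0.
  rewrite leNgt; apply/negP => pos.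
  have /nbhs_ballP[r /= r0 hr] : \forall t \near s0, 0 < u t by apply: (cvgr_gt _ (cu s0)).
  have [t Zt ts] := inf_adherent r0 hZ.
  have := lbZ t Zt; case: Zt => _ ut st.
  have : 0 < u t by apply: hr; rewrite /ball /= ler0_norm ?subr_le0 // opprB; move: ts; rewrite -/s0; lra.
  by rewrite ltNge ut.
have s00 : 0 < s0.
  by rewrite lt_neqAle s0ge andbT; apply/eqP => e; move: us0; rewrite -e u0 ler10.
have before t : 0 <= t -> t < s0 -> 0 < u t.
  by move=> t0 ts; rewrite ltNge; apply/negP => h; have := lbZ t (conj t0 h); rewrite leNgt ts.
have Gs0 : 0 < G s0.
  by apply: Gpos => // t /andP[t0 ts]; apply: before => //; exact: ltW.
pose P s := s `^ (1 - k) * (G s * G s) + 2 / (p + 1) * (s `^ k * u s `^ (p + 1))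
              - (k - 1) * (u s * G s).
(* P without the term whose power of u need not be continuous where u <= 0 *)
pose Q s := s `^ (1 - k) * (G s * G s) - (k - 1) * (u s * G s).
pose c := 2 * k / (p + 1) - (k - 1).
have p10 : 0 < p + 1 by lra.
have c0 : c <= 0.
  have k10 : 0 < k - 1 by lra.
  rewrite /c subr_le0 ler_pdivrMr //.
  by move: crit; rewrite ler_pdivrMr // => ?; lra.
have dP (t : R) : 0 < t -> t < s0 -> is_derive t (1 : R) P (c * (t `^ (k - 1) * u t `^ (p + 1))).
  move=> t0 ts; have ut := before t (ltW t0) ts.
  apply: pohozaev_derive => //; first exact: du.
  have := dG t t0; rewrite clamped_powRE // (ltW ut) /=; exact: ule (ltW t0).
have Pdec e t : 0 < e -> e <= t -> t < s0 -> P t <= P e.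
  move=> e0 et ts; rewrite -lerN2.
  apply: (@derive_ge0_le _ (fun s => - P s) (fun t => - (c * (t `^ (k - 1) * u t `^ (p + 1)))) _ _ et).
    move=> x /andP[ex xt]; have x0 := lt_trans e0 ex.
    split; first exact: is_derive_funN (dP x x0 (lt_trans xt ts)) erefl.
    by rewrite oppr_ge0 mulr_le0_ge0 // mulr_ge0 ?powR_ge0.
  apply: derivable_within_continuous => x; rewrite in_itv /= => /andP[ex xt].
  apply: (@ex_derive _ _ _ _ _ _ _ (is_derive_funN (dP x (lt_le_trans e0 ex) (le_lt_trans xt ts)) erefl)).
have Psmall e : 0 < e -> e <= 1 -> e < s0 -> P e <= 3 * e.
  move=> e0 e1 es; have ue := before e (ltW e0) es.
  have /andP[g0 g1] := Gb e e0.
  have h1 : e `^ (1 - k) * (G e * G e) <= e.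
    have E : e `^ (1 - k) * (e `^ k * 1) = e by rewrite mulr1 -powR_add // subrK powRr1 // ltW.
    rewrite -[leRHS]E ler_wpM2l ?powR_ge0 //; apply: ler_pM => //.
    apply: (le_trans g1); apply: (@le_trans _ _ (1 `^ k)); last by rewrite powR1.
    by apply: le_powR => //; lra.
  have h2 : e `^ k * u e `^ (p + 1) <= e.
    apply: (@le_trans _ _ (e * 1)); last by rewrite mulr1.
    apply: ler_pM; rewrite ?powR_ge0 //.
      by apply: ge1r_powR; rewrite ?e0 //; lra.
    apply: (@le_trans _ _ (1 `^ (p + 1))); last by rewrite powR1.
    by apply: le_powR => //; [lra|exact: ule (ltW e0)].
  have h3 : 0 <= (k - 1) * (u e * G e) by rewrite !mulr_ge0 ?(ltW ue) // subr_ge0 ltW.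
  have h4 : 2 / (p + 1) <= 2 by rewrite ler_pdivrMr //; lra.
  have h5 : 2 / (p + 1) * (e `^ k * u e `^ (p + 1)) <= 2 * e.
    by apply: ler_pM => //; [rewrite divr_ge0 // ltW|rewrite mulr_ge0 ?powR_ge0].
  by rewrite /P; move: h1 h3 h5; set A := _ * (G e * G e); set B := 2 / _ * _;
    set C := _ * (u e * G e); clear; lra.
have P0 t : 0 < t -> t < s0 -> P t <= 0.
  move=> t0 ts; rewrite leNgt; apply/negP => Pt.
  pose e := Num.min (Num.min 1 t) (P t / 6).
  have e0 : 0 < e by rewrite !lt_min ltr01 t0 divr_gt0.
  have e1 : e <= 1 by rewrite !ge_min lexx.
  have et : e <= t by rewrite !ge_min lexx !orbT.
  have eP : e <= P t / 6 by rewrite ge_min lexx orbT.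
  have h1 := Pdec e t e0 et ts.
  have h2 := Psmall e e0 e1 (le_lt_trans et ts).
  by move: h1 h2 eP Pt; clear; lra.
have Q0 t : 0 < t -> t < s0 -> Q t <= 0.
  move=> t0 ts; apply: le_trans (P0 t t0 ts); rewrite /Q /P lerD2r lerDl.
  by rewrite mulr_ge0 ?divr_ge0 ?(ltW p10) // mulr_ge0 ?powR_ge0.
have Qs0 : 0 < Q s0.
  rewrite /Q; apply: (@lt_le_trans _ _ (s0 `^ (1 - k) * (G s0 * G s0))).
    by rewrite !mulr_gt0 // powR_gt0.
  by rewrite lerDl oppr_ge0 mulr_ge0_le0 ?mulr_le0_ge0 ?subr_ge0 ?(ltW k1) // ltW.
have cG : {for s0, continuous G} := is_derive_cont (dG s0 s00).
have cQ : {for s0, continuous Q}.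
  apply: cvgB.
    by apply: cvgM; [exact: powR_continuous|exact: cvgM].
  by apply: cvgMl_tmp; apply: cvgM => //; exact: cu.
have /nbhs_ballP[r /= r0 hr] : \forall t \near s0, 0 < Q t by apply: (cvgr_gt _ cQ).
pose t := Num.max (s0 / 2) (s0 - r / 2).
have t1 : s0 / 2 <= t by rewrite le_max lexx.
have t2 : s0 - r / 2 <= t by rewrite le_max lexx orbT.
have t3 : t < s0 by rewrite gt_max; apply/andP; split; lra.
have : 0 < Q t by apply: hr; rewrite /ball /= gtr0_norm ?subr_gt0 //; move: t2 r0; clear; lra.
rewrite ltNge Q0 //; move: t1 s00; clear; lra.
Qed.

Lemma emden_solution {R : realType} (k p : R) :
  1 < k -> 1 < p -> (k + 1) / (k - 1) <= p ->
  exists U V : R -> R,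
    [/\ continuous U, forall s, 0 <= s -> 0 < U s,
        forall s : R, 0 < s -> is_derive s (1 : R) U (V s) &
        forall s : R, 0 < s -> is_derive s (1 : R) V (- (k * V s + U s `^ p) / s)].
Proof.
move=> k1 p1 crit; have [u [cu uE]] := picard_fixpoint k1 (ltW p1).
pose G := primitive (source k p u).
have cs := source_continuous k1 (ltW p1) cu.
have dG (s : R) : 0 < s -> is_derive s (1 : R) G (s `^ (k - 1) * clamped_powR p (u s)).
  move=> s0; have s1 : -1 < s by lra.
  have := is_derive_primitive cs s1.
  by rewrite /source trunc_powRE ?(ltW s0).
have du (s : R) : 0 < s -> is_derive s (1 : R) u (- (s `^ (- k) * G s)).
  move=> s0; apply: (near_eq_is_derive _ (is_derive_picard k1 (ltW p1) cu s0)).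
  near=> t; rewrite -uE //; apply/ltW; near: t; exact: lt_nbhsr.
have u0 : u 0 = 1 by rewrite uE // /picard lexx.
have Gpos s : 0 < s -> (forall t, 0 < t < s -> 0 < u t) -> 0 < G s.
  move=> s0 up; rewrite /G; have [c /andP[c0 cs'] ->] := primitive_mean cs s0.
  have uc : 0 < u c by rewrite up // c0.
  have m0 : 0 < Num.min (u c) 1 by rewrite lt_min uc ltr01.
  by rewrite /source /clamped_powR (trunc_powRE _ (ltW c0)) (trunc_powRE _ (ltW m0)) !mulr_gt0 // powR_gt0.
have pos := emden_positive k1 p1 crit u0 cu du dG
  (fun s => primitive_source_bounds k1 (ltW p1) cu) Gpos.
exists u, (fun s => - (s `^ (- k) * G s)); split => //.
  by move=> s /pos/andP[].
move=> s s0.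
have dpw : is_derive s (1 : R) (fun s => s `^ (- k)) (- k * s `^ (- k - 1)).
  exact: is_derive1_powR.
apply: (is_derive_eq (is_derive_funN (is_derive_funM dpw (dG s s0) erefl) erefl)).
have /andP[us us1] := pos s (ltW s0).
rewrite clamped_powRE ?us1 ?(ltW us) //.
have -> : s `^ (- k - 1) = s `^ (- k) / s by rewrite powR_add // powR_inv1 // ltW.
have -> : s `^ (k - 1) = s `^ k / s by rewrite powR_add // powR_inv1 // ltW.
have e2 : s `^ (- k) * s `^ k = 1 by rewrite -powR_add // addNr powRr0.
set g := G s; set F := u s `^ p; set Y := s `^ (- k) in e2 *; set W := s `^ k in e2 *.
transitivity (- (- k * (Y / s) * g + (Y * W) * (F / s))); first by ring.
by rewrite e2; field; rewrite gt_eqF.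
Unshelve. all: by end_near. Qed.

(** * Radial solutions on the whole space *)
(** Radial functions are written in terms of the squared norm, which is a polynomial. *)
Lemma C2_radial {R : realType} {N : nat} (F F1 F2 : R -> R) :
  (forall q : R, 0 < q -> is_derive q (1 : R) F (F1 q)) ->
  (forall q : R, 0 < q -> is_derive q (1 : R) F1 (F2 q)) ->
  (forall q : R, 0 < q -> {for q, continuous F2}) ->
  let u := fun x : 'rV[R]_N => F (nsq x) in
  C2_on [set x | x != 0] u /\
  forall x : 'rV[R]_N, x != 0 ->
    euler u x = 2 * nsq x * F1 (nsq x) /\
    \sum_k partial k (partial k u) x = 4 * nsq x * F2 (nsq x) + 2 * N%:R * F1 (nsq x).
Proof.
move=> dF dF1 cF2 u.
pose P (k : 'I_N) (y : 'rV[R]_N) := F1 (nsq y) * (2 * y 0 k).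
pose H (k l : 'I_N) (y : 'rV[R]_N) :=
  F2 (nsq y) * (2 * y 0 l) * (2 * y 0 k) + F1 (nsq y) * (2 * (l == k)%:R).
have du (x : 'rV[R]_N) k : x != 0 -> is_derive x (evec R k) u (P k x).
  by move=> x0; apply: is_derive_nsq; apply: dF; rewrite nsq_gt0.
have uP (x : 'rV[R]_N) k : x != 0 -> partial k u x = P k x.
  by move=> x0; exact: (@derive_val _ _ _ _ _ _ _ (du x k x0)).
have near0 (x : 'rV[R]_N) : x != 0 -> nbhs x (fun y : 'rV[R]_N => y != 0).
  by move=> x0; exact: (open_nbhs_nbhs (conj open_punctured x0)).
have nearP (x : 'rV[R]_N) k : x != 0 -> nbhs x (fun y : 'rV[R]_N => P k y = partial k u y).
  by move=> x0; apply: filterS (near0 x x0) => y y0; rewrite uP.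
have cn (G : R -> R) (x : 'rV[R]_N) : {for nsq x, continuous G} ->
    {for x, continuous (fun y : 'rV[R]_N => G (nsq y))}.
  move=> cG; apply: (@cvg_comp _ _ _ (@nsq R N) G _ (nbhs (nsq x))) => //.
  exact: nsq_continuous.
have ccoord (k : 'I_N) (x : 'rV[R]_N) : {for x, continuous (fun y : 'rV[R]_N => 2 * y 0 k)}.
  by apply: (cvgMl_tmp (FF := nbhs_filter x)); exact: coord_continuous.
have cP (x : 'rV[R]_N) k : x != 0 -> {for x, continuous (P k)}.
  move=> x0; apply: (cvgM (FF := nbhs_filter x)); last exact: ccoord.
  by apply: cn; apply: is_derive_cont (dF1 _ _); rewrite nsq_gt0.
have cH (x : 'rV[R]_N) k l : x != 0 -> {for x, continuous (H k l)}.
  move=> x0; have n0 : 0 < nsq x by rewrite nsq_gt0.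
  apply: (cvgD (FF := nbhs_filter x)).
    apply: (cvgM (FF := nbhs_filter x)); last exact: ccoord.
    by apply: (cvgM (FF := nbhs_filter x)); [apply: cn; exact: cF2|exact: ccoord].
  apply: (cvgMr_tmp (FF := nbhs_filter x)); apply: cn.
  exact: is_derive_cont (dF1 _ n0).
have dP (x : 'rV[R]_N) k l : x != 0 -> is_derive x (evec R l) (P k) (H k l x).
  move=> x0; have n0 : 0 < nsq x by rewrite nsq_gt0.
  have d1 := is_derive_nsq l (dF1 _ n0).
  have d2 : is_derive x (evec R l) (fun y : 'rV[R]_N => 2 * y 0 k) (2 * (l == k)%:R).
    rewrite -[x in is_derive x](addr0 x) -(scale0r (evec R l)).
    apply/is_derive_line.
    have -> : (fun s : R => 2 * (x + s *: evec R l) 0 k) =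
              (fun s => 2 * (x 0 k + s * (l == k)%:R)).
      by apply/funext => s; rewrite !mxE eqxx /= eq_sym.
    apply: is_derive_funZ (is_derive_funD (is_derive_funC _ _ erefl) (is_derive_funM (is_derive_funId _ erefl) (is_derive_funC _ _ erefl) erefl) erefl) _.
    by rewrite mul1r mulr0 addr0 add0r.
  apply: (is_derive_eq (is_deriveM d1 d2)).
  by rewrite /GRing.scale /= /H; ring.
have dpar (x : 'rV[R]_N) k l : x != 0 -> is_derive x (evec R l) (partial k u) (H k l x).
  by move=> x0; exact: (near_eq_is_derive (nearP x k x0) (dP x k l x0)).
have parE (x : 'rV[R]_N) k l : x != 0 -> partial l (partial k u) x = H k l x.
  by move=> x0; exact: (@derive_val _ _ _ _ _ _ _ (dpar x k l x0)).
split.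
- move=> x x0; split.
  + by apply: cn; apply: is_derive_cont (dF _ _); rewrite nsq_gt0.
  + move=> k; split; first exact: (@ex_derive _ _ _ _ _ _ _ (du x k x0)).
    have : P k @ x --> P k x := cP x k x0.
    rewrite -uP //; apply: cvg_trans; apply: (near_eq_cvg (FF := nbhs_filter x)); exact: nearP.
  + move=> k l; split; first exact: (@ex_derive _ _ _ _ _ _ _ (dpar x k l x0)).
    have : H k l @ x --> H k l x := cH x k l x0.
    rewrite -parE //; apply: cvg_trans; apply: (near_eq_cvg (FF := nbhs_filter x)).
    by apply: filterS (near0 x x0) => y y0; rewrite parE.
- move=> x x0; split.
    rewrite /euler; under eq_bigr => k _ do rewrite uP //.
    transitivity (\sum_k 2 * F1 (nsq x) * x 0 k ^+ 2).
      by apply: eq_bigr => k _; rewrite /P; ring.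
    by rewrite -mulr_sumr -/(nsq x); ring.
  under eq_bigr => k _ do rewrite parE //.
  transitivity (\sum_(k < N) (4 * F2 (nsq x) * x 0 k ^+ 2 + 2 * F1 (nsq x))).
    by apply: eq_bigr => k _; rewrite /H eqxx mulr1; ring.
  rewrite big_split /= -mulr_sumr -/(nsq x) sumr_const card_ord -[_ *+ N]mulr_natl; ring.
Qed.

(** With q = |x|^2 and z = |x|^sg / sg^2, the radial equation in q follows from the one in
    z because k - 1 = (N - 2 + a) / sg. *)
Theorem solution_supercritical (R : realType) (N : nat) (a b p : R) :
  (0 < N)%N -> 1 < p -> a - 2 < b -> 0 < N%:R - 2 + a -> p_S N a b <= p ->
  exists u : 'rV[R]_N -> R, positive_solution a b p u.
Proof.
move=> N0 p1 ab Na pS.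
pose sg := b - a + 2; have sg0 : 0 < sg by rewrite /sg; lra.
pose k := 1 + (N%:R - 2 + a) / sg.
have k1 : 1 < k by rewrite ltrDl divr_gt0.
have crit : (k + 1) / (k - 1) <= p.
  suff -> : (k + 1) / (k - 1) = p_S N a b by [].
  rewrite /k /p_S /sg; field; rewrite -/sg.
  by rewrite !gt_eqF //; rewrite /sg in sg0 *; lra.
have [U [V [cU Up dU dV]]] := emden_solution k1 p1 crit.
pose h := sg / 2.
pose z q := q `^ h / sg ^+ 2.
pose zp q := h * q `^ (h - 1) / sg ^+ 2.
pose zpp q := h * ((h - 1) * q `^ (h - 1 - 1)) / sg ^+ 2.
pose F q := U (z q).
pose F1 q := V (z q) * zp q.
pose V' s := - (k * V s + U s `^ p) / s.
pose F2 q := V' (z q) * zp q * zp q + V (z q) * zpp q.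
have s20 : 0 < sg ^+ 2 by rewrite exprn_gt0.
have zgt q : 0 < q -> 0 < z q by move=> q0; rewrite divr_gt0 // powR_gt0.
have dz (q : R) : 0 < q -> is_derive q (1 : R) z (zp q).
  move=> q0; apply: is_derive_funM (is_derive1_powR h q0) (is_derive_funC _ _ erefl) _.
  by rewrite mulr0 addr0.
have dzp (q : R) : 0 < q -> is_derive q (1 : R) zp (zpp q).
  move=> q0; apply: is_derive_funM (is_derive_funZ (is_derive1_powR (h - 1) q0) erefl) (is_derive_funC _ _ erefl) _.
  by rewrite mulr0 addr0.
have dF (q : R) : 0 < q -> is_derive q (1 : R) F (F1 q).
  by move=> q0; exact: is_derive_fun_comp (dU _ (zgt q q0)) (dz q q0) erefl.
have dF1 (q : R) : 0 < q -> is_derive q (1 : R) F1 (F2 q).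
  move=> q0; apply: is_derive_funM (is_derive_fun_comp (dV _ (zgt q q0)) (dz q q0) erefl) (dzp q q0) _.
  by [].
have cF2 (q : R) : 0 < q -> {for q, continuous F2}.
  move=> q0; have z0 := zgt q q0.
  have cz : {for q, continuous z} := is_derive_cont (dz q q0).
  have czp : {for q, continuous zp} := is_derive_cont (dzp q q0).
  have cV : {for z q, continuous V} := is_derive_cont (dV _ z0).
  have cV' : {for z q, continuous V'}.
    apply: cvgM; last by apply: cvgV; [rewrite gt_eqF|exact: cvg_id].
    apply: cvgN; apply: cvgD; first by apply: cvgMl_tmp; exact: cV.
    apply: (@cvg_comp _ _ _ U (fun y => y `^ p) _ (nbhs (U (z q)))); first exact: cU.
    by apply: powR_continuous; apply: Up; exact: ltW.
  have cVz : (fun q => V (z q)) @ q --> V (z q).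
    by apply: (@cvg_comp _ _ _ z V _ (nbhs (z q))).
  have cV'z : (fun q => V' (z q)) @ q --> V' (z q).
    by apply: (@cvg_comp _ _ _ z V' _ (nbhs (z q))).
  apply: cvgD; apply: cvgM => //; first exact: cvgM.
  apply: cvgMr_tmp; apply: cvgMl_tmp; apply: cvgMl_tmp.
  exact: powR_continuous.
have [Cu lap] := C2_radial (N := N) dF dF1 cF2.
pose u (x : 'rV[R]_N) := F (nsq x).
have zE (x : 'rV[R]_N) : z (nsq x) = enorm x `^ sg / sg ^+ 2 by rewrite powR_enorm.
exists u; split.
- by move=> x; apply: Up; rewrite zE divr_ge0 ?powR_ge0 // ltW.
- exact: Cu.
- move=> x; apply: (@cvg_comp _ _ _ (fun x => z (nsq x)) U _ (nbhs (z (nsq x)))); last exact: cU.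
  rewrite zE; under eq_fun do rewrite zE.
  apply: (cvgMr_tmp (FF := nbhs_filter x)).
  rewrite -(trunc_powRE _ (enorm_ge0 x)); under eq_fun do rewrite -(trunc_powRE _ (enorm_ge0 _)).
  apply: (@cvg_comp _ _ _ (@enorm R N) (trunc_powR sg) _ (nbhs (enorm x))).
    exact: enorm_continuous.
  exact: trunc_powR_continuous.
- move=> x x0; have [eu lu] := lap x x0.
  have n0 : 0 < nsq x by rewrite nsq_gt0.
  have e0 : 0 < enorm x by rewrite enorm_gt0.
  rewrite (divergence_expand a Cu x0) eu lu.
  have -> : enorm x `^ b = enorm x `^ a * nsq x `^ (h - 1).
    have -> : b = a + (sg - 2) by rewrite /sg; ring.
    by rewrite powR_add // (powR_enorm x (sg - 2)); congr (_ * _ `^ _); rewrite /h; field.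
  have E (c X Y Z : R) : X + Y * Z = 0 -> c * X + c * Y * Z = 0.
    by rewrite -mulrA -mulrDr => ->; rewrite mulr0.
  apply: E.
  have z0 := zgt _ n0.
  rewrite /u /F; set q := nsq x in n0 z0 *.
  have zpE : zp q = h * z q / q.
    by rewrite /zp /z powR_add // powR_inv1 ?(ltW n0) //; field; rewrite !gt_eqF.
  have zppE : zpp q = h * (h - 1) * z q / q ^+ 2.
    rewrite /zpp /z !powR_add // !powR_inv1 ?(ltW n0) //; field; rewrite !gt_eqF //.
  have -> : q `^ (h - 1) = sg ^+ 2 * z q / q.
    by rewrite /z powR_add // powR_inv1 ?(ltW n0) //; field; rewrite !gt_eqF.
  rewrite /F2 /F1 /V' zpE zppE.
  set W := V (z q); set X := U (z q) `^ p; set y := z q in z0 *.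
  have -> : h = sg / 2 by [].
  rewrite /k; field; rewrite !gt_eqF //.
Qed.

Theorem corollary1 (R : realType) (N : nat) (a b p : R)
    (hN : (3 <= N)%N) (hp : 1 < p) (hab : a - 2 < b) (ha : - N%:R < a - 2) :
  (p < p_S N a b ->
     ~ exists u : 'rV[R]_N -> R, positive_solution a b p u) /\
  (p_S N a b <= p ->
     exists u : 'rV[R]_N -> R, positive_solution a b p u).
Proof.
have N0 : (0 < N)%N := ltnW (ltnW hN).
split; first exact: no_solution_subcritical.
by apply: solution_supercritical => //; lra.
Qed.
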